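(* Let $a\in\mathbb{I}_1$, $\cdot a:\mathbb{I}_1\to\mathbb{I}_1$, $b\mapsto ba$ (a homomorphism of left $\mathbb{I}_1$-modules), $a\cdot:\mathbb{I}_1\to\mathbb{I}_1$, $b\mapsto ab$ (a homomorphism of right $\mathbb{I}_1$-modules), and let $l_{\mathbb{I}_1}$ be the length function on the set of (left or right) $\mathbb{I}_1$-modules. Then: (1) (a) $l_{\mathbb{I}_1}(\ker(\cdot a))<\infty$ iff $l_{\mathbb{I}_1}(\mathrm{coker}(\cdot a))<\infty$ iff $a\notin F$; (b) $l_{\mathbb{I}_1}(\mathrm{im}(\cdot a))<\infty$ iff $a\in F$. (2) (a) $l_{\mathbb{I}_1}(\ker(a\cdot))<\infty$ iff $l_{\mathbb{I}_1}(\mathrm{coker}(a\cdot))<\infty$ iff $a\notin F$; (b) $l_{\mathbb{I}_1}(\mathrm{im}(a\cdot))<\infty$ iff $a\in F$. In (1) the lengths are lengths of left modules and in (2) lengths of right modules.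
   Context: $K$ is a field of characteristic zero. $\mathbb{I}_1$ is the subalgebra of $\mathrm{End}_K(K[x])$ generated by (multiplication by) $x$, $\partial=\frac{d}{dx}$ and $\int: x^n\mapsto \frac{x^{n+1}}{n+1}$. Put $e_{ij}:=\int^i\partial^j-\int^{i+1}\partial^{j+1}$ ($i,j\ge0$) and $F:=\bigoplus_{i,j\ge0}Ke_{ij}$, an ideal of $\mathbb{I}_1$. *)

(* Defs.v *)
From HB Require Import structures.
From mathcomp Require Import all_boot all_order all_algebra generic_quotient.
From mathcomp Require Import ring_quotient.
From mathcomp Require Import all_classical all_reals.

Set Implicit Arguments.
Unset Strict Implicit.
Unset Printing Implicit Defensive.

Import Order.TTheory GRing.Theory Num.Theory.
Local Open Scope classical_set_scope.
Local Open Scope ring_scope.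

Section Length.
Variables (R : pzRingType) (M : lmodType R).

(* N 0 < N 1 < ... < N n; the values N i with i > n are irrelevant. *)
Definition submod_chain (n : nat) (N : nat -> submodClosed M) : Prop :=
  forall i, (i < n)%N -> [set` N i] `<` [set` N i.+1].

Definition chain_lengths : set nat :=
  [set n | exists N : nat -> submodClosed M, submod_chain n N].

(* The length of M as an element of {0, 1, ...} with +oo adjoined, taken inside
   \bar int. The default value of [supremum] is never used: mlength_ub and
   mlength_le say that this is a least upper bound. *)
Definition mlength : \bar int :=
  supremum (0%:Z)%:E [set (n%:Z)%:E | n in chain_lengths].

Lemma chain_lengths0 : chain_lengths 0.
Proof.
have c : subsemimod_closed (fun _ : M => true) by [].
pose Sm := GRing.isSubmodClosed.Build R M _ c.
pose S : submodClosed M := HB.pack (fun _ : M => true) Sm.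
by exists (fun=> S).
Qed.

Lemma chain_lengthsW m n : (m <= n)%N -> chain_lengths n -> chain_lengths m.
Proof. by move=> mn [N Nn]; exists N => i im; apply/Nn/(leq_trans im). Qed.

Lemma mlength_subproof :
  supremums [set (n%:Z)%:E | n in chain_lengths] !=set0.
Proof.
case: (pselect (exists b, forall n, chain_lengths n -> (n <= b)%N)) => [|nb].
  move=> [b ub_b].
  have exn : exists n, `[< chain_lengths n >].
    by exists 0%N; apply/asboolP/chain_lengths0.
  have ubn n : `[< chain_lengths n >] -> (n <= b)%N by move=> /asboolP/ub_b.
  case: (ex_maxnP exn ubn) => m /asboolP Lm max_m.
  exists (m%:Z)%:E; split=> [_ [n Ln <-]|y]; last by apply; exists m.
  by rewrite lee_fin lez_nat max_m//; apply/asboolP.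
exists +oo%E; split=> [_ [n Ln <-]|[y| |] uby]; rewrite ?leey//; last first.
  by have := uby _ (ex_intro2 _ _ 0%N chain_lengths0 erefl).
exfalso; apply: nb; exists `|y|%N => n Ln.
have := uby _ (ex_intro2 _ _ n Ln erefl); rewrite lee_fin => ny.
by rewrite -lez_nat abszE (le_trans ny)// ler_norm.
Qed.

Lemma mlength_supremums :
  supremums [set (n%:Z)%:E | n in chain_lengths] mlength.
Proof.
have [l ls] := mlength_subproof; rewrite /mlength /supremum; case: eqP => [E|_].
  have : [set (n%:Z)%:E | n in chain_lengths] (0%:Z)%:E.
    by exists 0%N => //; exact: chain_lengths0.
  by rewrite E.
by case: xgetP => // /(_ l).
Qed.

Lemma mlength_ub n : chain_lengths n -> ((n%:Z)%:E <= mlength)%E.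
Proof. by move=> Ln; apply: mlength_supremums.1; exists n. Qed.

Lemma mlength_le (y : \bar int) :
  (forall n, chain_lengths n -> ((n%:Z)%:E <= y)%E) -> (mlength <= y)%E.
Proof. by move=> uby; apply: mlength_supremums.2 => _ [n /uby ny <-]. Qed.

Lemma mlength_lt_pinfty :
  (mlength < +oo)%E <-> exists b, forall n, chain_lengths n -> (n <= b)%N.
Proof.
split=> [|[b ub_b]]; last first.
  apply: (@le_lt_trans _ _ (b%:Z)%:E); last by rewrite ltry.
  by apply: mlength_le => n /ub_b nb; rewrite lee_fin lez_nat.
move: mlength_ub; case: mlength => [y| |] uby // _; last first.
  by have := uby _ chain_lengths0.
exists `|y|%N => n /uby; rewrite lee_fin => ny.
by rewrite -lez_nat abszE (le_trans ny)// ler_norm.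
Qed.

End Length.

Section KernelImageCokernel.
Variables (R : pzRingType) (U V : lmodType R) (f : {linear U -> V}).

Definition ker_pred : {pred U} := fun x => f x == 0.

Definition im_pred : {pred V} := fun y => `[< exists x, f x = y >].

Fact ker_closed : subsemimod_closed ker_pred.
Proof.
split; first split=> [|x y].
- by rewrite unfold_in linear0.
- by rewrite !unfold_in linearD => /eqP-> /eqP->; rewrite addr0.
- by move=> c x; rewrite !unfold_in linearZ => /eqP->; rewrite /= scaler0.
Qed.
HB.instance Definition _ := GRing.isSubmodClosed.Build R U ker_pred ker_closed.

Fact im_closed : subsemimod_closed im_pred.
Proof.
split; first split=> [|x y].
- by apply/asboolP; exists 0; rewrite linear0.
- move=> /asboolP[u <-] /asboolP[v <-].
  by apply/asboolP; exists (u + v); rewrite linearD.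
- by move=> c x /asboolP[u <-]; apply/asboolP; exists (c *: u); rewrite linearZ.
Qed.
HB.instance Definition _ := GRing.isSubmodClosed.Build R V im_pred im_closed.

Definition ker := {x : U | x \in ker_pred}.
HB.instance Definition _ := SubChoice.on ker.
HB.instance Definition _ := [SubChoice_isSubLmodule of ker by <:].

Definition im := {y : V | y \in im_pred}.
HB.instance Definition _ := SubChoice.on im.
HB.instance Definition _ := [SubChoice_isSubLmodule of im by <:].

Definition coker := Quotient.quot im_pred.
HB.instance Definition _ := ZmodQuotient.on coker.

Local Open Scope quotient_scope.

Definition coker_scale (c : R) (q : coker) : coker := \pi_coker (c *: repr q).

Lemma pi_coker_scale c x : coker_scale c (\pi_coker x) = \pi_coker (c *: x).
Proof.
apply/eqP; rewrite -Quotient.idealrBE -scalerBr rpredZ//.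
by rewrite Quotient.idealrBE reprK.
Qed.

Fact coker_scaleA a b q :
  coker_scale a (coker_scale b q) = coker_scale (a * b) q.
Proof. by elim/quotW: q => x; rewrite (pi_coker_scale b) 2!pi_coker_scale scalerA. Qed.

Fact coker_scale1 : left_id 1 coker_scale.
Proof. by elim/quotW=> x; rewrite pi_coker_scale scale1r. Qed.

Fact coker_scaleDr : right_distributive coker_scale +%R.
Proof.
move=> c; elim/quotW=> x; elim/quotW=> y.
by rewrite -raddfD !pi_coker_scale scalerDr raddfD.
Qed.

Fact coker_scaleDl q : {morph coker_scale^~ q : a b / a + b}.
Proof.
by move=> a b; elim/quotW: q => x; rewrite !pi_coker_scale scalerDl raddfD.
Qed.

HB.instance Definition _ :=
  GRing.Zmodule_isLmodule.Build R coker coker_scaleA coker_scale1 coker_scaleDr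
    coker_scaleDl.

End KernelImageCokernel.

Section RingMultiplications.
Variables (A : nzRingType) (a : A).

Definition right_mul (b : A^o) : A^o := b * a.

Fact right_mul_linear : linear right_mul.
Proof. by move=> c x y; rewrite /right_mul mulrDl -mulrA. Qed.
HB.instance Definition _ :=
  GRing.isLinear.Build A A^o A^o *:%R right_mul right_mul_linear.

(* A right A-module is a left module over the converse ring A^c; the right
   regular module is A^c^o, where c *: b is b * c computed in A. *)
Definition left_mul (b : A^c^o) : A^c^o := a * (b : A).

Fact left_mul_linear : linear left_mul.
Proof. by move=> c x y; rewrite /left_mul mulrDr mulrA. Qed.
HB.instance Definition _ :=
  GRing.isLinear.Build A^c A^c^o A^c^o *:%R left_mul left_mul_linear.

End RingMultiplications.

Section GeneratedSubalgebra.
Variables (R : pzRingType) (A : algType R) (S : set A).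

Definition subalg_gen : {pred A} :=
  fun x => `[< forall B : subalgClosed A, S `<=` [set` B] -> x \in B >].

Fact subalg_gen_closed : GRing.subsemialg_closed subalg_gen.
Proof.
split=> [||c x /asboolP Sx|x y /asboolP Sx /asboolP Sy].
- by apply/asboolP => B _; exact: rpred1.
- split=> [|x y /asboolP Sx /asboolP Sy]; apply/asboolP => B SB.
    exact: rpred0.
  by rewrite rpredD ?Sx ?Sy.
- by apply/asboolP => B SB; rewrite rpredZ ?Sx.
- by apply/asboolP => B SB; rewrite rpredM ?Sx ?Sy.
Qed.
HB.instance Definition _ :=
  GRing.isSubalgClosed.Build R A subalg_gen subalg_gen_closed.

Lemma mem_subalg_gen x : S x -> x \in subalg_gen.
Proof. by move=> Sx; apply/asboolP => B; apply. Qed.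

End GeneratedSubalgebra.

Section Endomorphisms.
Variable K : fieldType.

Definition endo := {linear {poly K} -> {poly K}}.
HB.instance Definition _ := Choice.on endo.
Implicit Types f g h : endo.

Lemma endoP f g : f =1 g -> f = g.
Proof.
case: f g => [f [[f1] [f2]]] [g [[g1] [g2]]] /= fg.
have {fg}E : f = g by apply/funext.
case: _ / E g1 g2 => g1 g2.
by rewrite (Prop_irrelevance f1 g1) (Prop_irrelevance f2 g2).
Qed.

Definition endo_zero : endo := \0.
Definition endo_opp f : endo := \- f.
Definition endo_add f g : endo := f \+ g.
Definition endo_one : endo := idfun.
Definition endo_mul f g : endo := f \o g.
Definition endo_scale (c : K) f : endo := c \*: f.

Fact endo_addA : associative endo_add.
Proof. by move=> f g h; apply: endoP => p /=; rewrite addrA. Qed.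
Fact endo_addC : commutative endo_add.
Proof. by move=> f g; apply: endoP => p /=; rewrite addrC. Qed.
Fact endo_add0 : left_id endo_zero endo_add.
Proof. by move=> f; apply: endoP => p /=; rewrite add0r. Qed.
Fact endo_addN : left_inverse endo_zero endo_opp endo_add.
Proof. by move=> f; apply: endoP => p /=; rewrite addNr. Qed.
HB.instance Definition _ :=
  GRing.isZmodule.Build endo endo_addA endo_addC endo_add0 endo_addN.

Fact endo_mulA : associative endo_mul.
Proof. by move=> f g h; apply: endoP. Qed.
Fact endo_mul1l : left_id endo_one endo_mul.
Proof. by move=> f; apply: endoP. Qed.
Fact endo_mul1r : right_id endo_one endo_mul.
Proof. by move=> f; apply: endoP. Qed.
Fact endo_mulDl : left_distributive endo_mul +%R.
Proof. by move=> f g h; apply: endoP. Qed.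
Fact endo_mulDr : right_distributive endo_mul +%R.
Proof. by move=> f g h; apply: endoP => p /=; rewrite linearD. Qed.
Fact endo_one_neq0 : endo_one != 0.
Proof.
apply/eqP => /(congr1 (fun f : endo => f 1)) /= /eqP.
by rewrite oner_eq0.
Qed.
HB.instance Definition _ := GRing.Zmodule_isNzRing.Build endo
  endo_mulA endo_mul1l endo_mul1r endo_mulDl endo_mulDr endo_one_neq0.

Fact endo_scaleA a b f :
  endo_scale a (endo_scale b f) = endo_scale (a * b) f.
Proof. by apply: endoP => p /=; rewrite scalerA. Qed.
Fact endo_scale1 : left_id 1 endo_scale.
Proof. by move=> f; apply: endoP => p /=; rewrite scale1r. Qed.
Fact endo_scaleDr : right_distributive endo_scale +%R.
Proof. by move=> c f g; apply: endoP => p /=; rewrite scalerDr. Qed.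
Fact endo_scaleDl f : {morph endo_scale^~ f : a b / a + b}.
Proof. by move=> a b; apply: endoP => p /=; rewrite scalerDl. Qed.
HB.instance Definition _ := GRing.Zmodule_isLmodule.Build K endo
  endo_scaleA endo_scale1 endo_scaleDr endo_scaleDl.

Fact endo_scalerAl c f g : c *: (f * g) = (c *: f) * g.
Proof. by apply: endoP. Qed.
HB.instance Definition _ := GRing.Lmodule_isLalgebra.Build K endo endo_scalerAl.

Fact endo_scalerAr c f g : c *: (f * g) = f * (c *: g).
Proof. by apply: endoP => p /=; rewrite linearZ. Qed.
HB.instance Definition _ := GRing.Lalgebra_isAlgebra.Build K endo endo_scalerAr.

Definition mulX (p : {poly K}) : {poly K} := 'X * p.

Fact mulX_linear : linear mulX.
Proof. by move=> c p q; rewrite /mulX mulrDr scalerAr. Qed.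
HB.instance Definition _ :=
  GRing.isLinear.Build K {poly K} {poly K} *:%R mulX mulX_linear.

Definition mulX_endo : endo := mulX.

Definition deriv_endo : endo := @deriv K.

Definition integ (p : {poly K}) : {poly K} :=
  \sum_(i < size p) (p`_i / i.+1%:R) *: 'X^(i.+1).

Lemma coef_integ p i : (integ p)`_i = p`_i.-1 / i%:R.
Proof.
rewrite /integ coef_sum; case: i => [|i] /=.
  by rewrite invr0 mulr0 big1// => j _; rewrite coefZ coefXn mulr0.
have [pi|ip] := ltnP i (size p).
  rewrite (bigD1 (Ordinal pi))//= coefZ coefXn eqxx mulr1 big1 ?addr0// => j ji.
  rewrite coefZ coefXn eqSS; case: eqP => [E|]; rewrite ?mulr0//.
  by case/eqP: ji; apply/val_inj.
rewrite big1 => [|j _]; first by rewrite nth_default// mul0r.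
rewrite coefZ coefXn eqSS; case: eqP => [E|]; rewrite ?mulr0//.
by move: (ltn_ord j); rewrite -E ltnNge ip.
Qed.

Lemma integXn n : integ 'X^n = n.+1%:R^-1 *: 'X^(n.+1).
Proof.
apply/polyP => i; rewrite coef_integ coefZ !coefXn.
case: i => [|i] /=; first by rewrite invr0 !mulr0.
by rewrite eqSS; case: eqP => [->|]; rewrite ?mul1r ?mulr1 ?mul0r ?mulr0.
Qed.

Fact integ_linear : linear integ.
Proof.
move=> c p q; apply/polyP => i.
by rewrite coefD coefZ !coef_integ coefD coefZ mulrDl mulrA.
Qed.
HB.instance Definition _ :=
  GRing.isLinear.Build K {poly K} {poly K} *:%R integ integ_linear.

Definition integ_endo : endo := integ.

Definition I1_gens : set endo := [set mulX_endo; deriv_endo; integ_endo].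

Definition I1 := {f : endo | f \in subalg_gen I1_gens}.
HB.instance Definition _ := SubChoice.on I1.
HB.instance Definition _ := [SubChoice_isSubAlgebra of I1 by <:].

Definition I1_x : I1 := exist _ mulX_endo
  (mem_subalg_gen (or_introl (or_introl erefl))).
Definition I1_deriv : I1 := exist _ deriv_endo
  (mem_subalg_gen (or_introl (or_intror erefl))).
Definition I1_integ : I1 := exist _ integ_endo
  (mem_subalg_gen (or_intror erefl)).

Definition I1_e (i j : nat) : I1 :=
  I1_integ ^+ i * I1_deriv ^+ j - I1_integ ^+ i.+1 * I1_deriv ^+ j.+1.

(* The K-linear span of the elements I1_e i j. *)
Definition I1_F : set I1 :=
  [set a | exists (n : nat) (c : 'M[K]_n),
     a = \sum_(i < n) \sum_(j < n) c i j *: I1_e i j].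

End Endomorphisms.

Arguments I1_F K : clear implicits.

(* Main.v *)
From HB Require Import structures.
Require Import Defs.
From mathcomp Require Import all_boot all_order all_algebra generic_quotient.
From mathcomp Require Import ring_quotient zify.
From mathcomp Require Import all_classical all_reals.

(** Write [T] for differentiation, [S] for integration, [H = T * x] and
    [e = 1 - S * T]. Then [T * S = 1], [T * p(H) = p(H + 1) * T],
    [p(H) * S = S * p(H + 1)] and [e * p(H) = p(1) * e], and the algebra is
    generated by [S], [T] and [H]. Its ideal [F] consists of the elements killed
    by a power of [T] on the left, or equivalently by a power of [S] on the right.
    All these facts are symmetric under reversing products and exchanging [S] and
    [T], so that the assertions on right modules are the assertions on left
    modules for the converse ring ([integro_diff_converse]).

    Modulo [F] the element [T] becomes invertible and the quotient is the skew
    Laurent ring in [T] over [K[H]], a domain that is not Artinian but whose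
    quotients by nonzero left ideals have finite length. On the other side [F] is
    the ring of finite matrices, where a left ideal is a space of rows. Accordingly
    a left ideal [N] is determined by two spaces ([left_ideal_spaces]):
    - the polynomials [w] such that the row [\sum_j w_j * e * T ^+ j] is in [N];
    - the operators [P = \sum_k P_k(H) * T ^+ k] such that [T ^+ n * P] is in [N]
      for some [n]; this space describes the image of [N] modulo [F].

    A subspace of polynomials that is controlled in large degrees is measured by
    the degrees of its elements, and these change whenever the subspace grows
    ([count_sizes_lt]). A nonzero space of operators is measured by the sum of
    its least order and of the least degree of a leading coefficient, and this
    number drops whenever the space grows ([ore_measure_lt]): otherwise the
    quotient of the two spaces would be annihilated by some nonzero [p(H)], hence
    by [p(H) - p(H - 1)], and so on, hence by a nonzero constant as [K] has
    characteristic zero. Both measures together bound the lengths of chains of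
    left ideals ([finite_between_left_ideals]).

    If [a] is outside [F], right multiplication by [a] shifts the degrees of long
    rows by a constant ([first_row_mul_size]). Hence the rows in the kernel of
    [b |-> b * a] have bounded degree, the rows in its image take every large
    degree, and kernel and cokernel have finite length. This shift also
    shows that [b * a] is in [F] only if [b] or [a] is ([finite_partM]), and as
    [T - 1] has no left inverse modulo [F], the left ideals generated by
    the [(T - 1) ^+ n * a] decrease strictly. So every left ideal that is not
    inside [F] has infinite length, and so has the quotient by [F]. If [a] is in
    [F], the rows among its left multiples have bounded degree and the image has
    finite length, while the kernel contains a power of [T] and the cokernel maps
    onto the quotient by [F]. *)

Set Implicit Arguments.
Unset Strict Implicit.
Unset Printing Implicit Defensive.

Import GRing.Theory.
Local Open Scope classical_set_scope.
Local Open Scope ring_scope.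

(** * Lengths as bounds on chains of submodules *)

Section SubmoduleChains.
Variable R : pzRingType.

Definition submodule (M : lmodType R) (N : set M) : Prop :=
  [/\ N 0, forall x y, N x -> N y -> N (x + y) & forall c x, N x -> N (c *: x)].

Definition chain_between (M : lmodType R) (lo hi : set M) (n : nat) : Prop :=
  exists N : nat -> set M,
    (forall i, [/\ submodule (N i), lo `<=` N i & N i `<=` hi]) /\
    (forall i, (i < n)%N -> N i `<` N i.+1).

Definition finite_between (M : lmodType R) (lo hi : set M) : Prop :=
  exists b, forall n, chain_between lo hi n -> (n <= b)%N.

Lemma chain_lengthsE (M : lmodType R) n :
  chain_lengths M n <-> chain_between [set 0 : M] setT n.
Proof.
split=> [[N Nlt]|[N [subN Nlt]]].
  exists (fun i => [set` N i]); split=> // i; split=> //.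
  - split=> [|x y|c x] /=; [exact: rpred0|exact: rpredD|exact: rpredZ].
  - by move=> _ ->; exact: rpred0.
have closed i : subsemimod_closed (fun x => `[< N i x >]).
  have [[N0 ND NZ] _ _] := subN i.
  split; first by split=> [|x y /asboolP Nx /asboolP Ny]; apply/asboolP; auto.
  by move=> c x /asboolP Nx; apply/asboolP/NZ.
pose B i := GRing.isSubmodClosed.Build R M _ (closed i).
pose C i : submodClosed M := HB.pack (fun x => `[< N i x >]) (B i).
have CE i : [set` C i] = N i.
  by apply/funext => x /=; rewrite propeqE; split=> /asboolP.
by exists C => i /Nlt; rewrite !CE.
Qed.

Lemma submodule_image (U V : lmodType R) (g : {linear U -> V}) (N : set U) :
  submodule N -> submodule (g @` N).
Proof.
move=> [N0 ND NZ]; split=> [|_ _ [x Nx <-] [y Ny <-]|c _ [x Nx <-]].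
- by exists 0; rewrite ?linear0.
- by exists (x + y); rewrite ?linearD//; exact: ND.
- by exists (c *: x); rewrite ?linearZ//; exact: NZ.
Qed.

Lemma submodule_preimage (U V : lmodType R) (g : {linear U -> V}) (N : set V) :
  submodule N -> submodule (g @^-1` N).
Proof.
move=> [N0 ND NZ]; split=> [|x y|c x] /=.
- by rewrite linear0.
- by rewrite linearD; exact: ND.
- by rewrite linearZ; exact: NZ.
Qed.

(** The correspondence between submodules containing the kernel and submodules
    of the image; it reduces chains in kernels, images and cokernels to chains
    in the source or target. *)
Lemma chain_between_linear (U V : lmodType R) (g : {linear U -> V}) n :
  chain_between [set x | g x = 0] setT n <->
  chain_between [set 0] (range g) n.
Proof.
split=> -[N [subN Nlt]].
  exists (fun i => g @` N i); split=> [i|i /Nlt [sub /existsNP[x]]].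
    have [sN kN _] := subN i; split; first exact: submodule_image.
      by move=> _ ->; exists 0; [case: sN|rewrite linear0].
    by move=> _ [x _ <-]; exists x.
  move=> /not_implyP[Nx Nx']; split; first exact: image_subset.
  move=> /(_ _ (ex_intro2 _ _ x Nx erefl)) [y Ny gyx]; apply: Nx'.
  (* [x] differs by an element of the kernel from some [y] in [N i]. *)
  have [[_ ND _] kN _] := subN i.
  rewrite -(subrK y x); apply: ND => //; apply: kN => /=.
  by rewrite linearB /= gyx subrr.
exists (fun i => g @^-1` N i); split=> [i|i /Nlt [sub nsub]].
  have [sN kN _] := subN i; split=> //; first exact: submodule_preimage.
  by move=> x /= ->; case: sN.
split; first exact: preimage_subset.
move=> sub'; apply: nsub => y Ny.
by have [_ _ /(_ _ Ny) [x _ gxy]] := subN i.+1; rewrite -gxy in Ny *; exact: sub'.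
Qed.

Lemma finite_between_measure (M : lmodType R) (lo hi : set M)
    (mu : set M -> nat) (b : nat) :
  (forall N, submodule N -> lo `<=` N -> N `<=` hi -> (mu N <= b)%N) ->
  (forall N N', submodule N -> submodule N' -> lo `<=` N -> N' `<=` hi ->
     N `<` N' -> (mu N < mu N')%N) ->
  finite_between lo hi.
Proof.
move=> mub mult; exists b => n [N [subN Nlt]].
suff H i : (i <= n)%N -> (i <= mu (N i))%N.
  by have [sN lN hN] := subN n; rewrite (leq_trans (H n _))// mub.
elim: i => // i IH ilt; apply: leq_ltn_trans (IH (ltnW ilt)) _.
by have [? ? ?] := subN i; have [? ? ?] := subN i.+1; apply: mult => //; exact: Nlt.
Qed.

Variables (U V : lmodType R) (f : {linear U -> V}).

Lemma mlength_finite_between (M W : lmodType R) (lo hi : set W) :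
  (forall n, chain_lengths M n <-> chain_between lo hi n) ->
  (mlength M < +oo)%E <-> finite_between lo hi.
Proof.
move=> E; rewrite mlength_lt_pinfty.
by split=> -[b ub]; exists b => n /E/ub.
Qed.

Lemma mlength_ker :
  (mlength (ker f) < +oo)%E <-> finite_between [set 0] [set x | f x = 0].
Proof.
apply: mlength_finite_between => n; rewrite chain_lengthsE.
pose g : {linear ker f -> U} := (val : ker f -> U).
have -> : [set 0] = [set x | g x = 0].
  apply/seteqP; split=> x /=; first by move=> ->; exact: (linear0 g).
  by move=> gx; apply/val_inj; rewrite /= gx; exact/esym/(linear0 g).
rewrite chain_between_linear; suff -> : range g = [set x | f x = 0] by [].
apply/seteqP; split=> [_ [[x fx] _ <-]|x fx] /=; first exact/eqP.
by exists (exist _ x (introT eqP fx)).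
Qed.

Lemma mlength_im :
  (mlength (im f) < +oo)%E <-> finite_between [set 0] (range f).
Proof.
apply: mlength_finite_between => n; rewrite chain_lengthsE.
pose g : {linear im f -> V} := (val : im f -> V).
have -> : [set 0] = [set x | g x = 0].
  apply/seteqP; split=> x /=; first by move=> ->; exact: (linear0 g).
  by move=> gx; apply/val_inj; rewrite /= gx; exact/esym/(linear0 g).
rewrite chain_between_linear; suff -> : range g = range f by [].
apply/seteqP; split=> [_ [[y imy] _ <-]|y [x _ fx]] /=.
  by have /asboolP[x <-] := imy; exists x.
have imy : y \in im_pred f by apply/asboolP; exists x.
by exists (exist _ y imy).
Qed.

Definition coker_proj (y : V) : coker f := (\pi_(coker f) y)%qT.

Fact coker_proj_linear : linear coker_proj.
Proof. by move=> c x y; rewrite /coker_proj raddfD /= -pi_coker_scale. Qed.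
HB.instance Definition _ :=
  GRing.isLinear.Build R V (coker f) *:%R coker_proj coker_proj_linear.

Lemma mlength_coker :
  (mlength (coker f) < +oo)%E <-> finite_between (range f) setT.
Proof.
apply: mlength_finite_between => n; rewrite chain_lengthsE.
have <- : range coker_proj = setT.
  by apply/seteqP; split=> // q _; exists (repr q); rewrite // /coker_proj reprK.
rewrite -chain_between_linear.
suff -> : [set x | coker_proj x = 0] = range f by [].
apply/seteqP; split=> y /=.
  rewrite -(linear0 coker_proj) => /eqP.
  rewrite -Quotient.idealrBE subr0 => /asboolP[x <-].
  by exists x.
move=> [x _ fx]; rewrite -(linear0 coker_proj); apply/eqP.
by rewrite -Quotient.idealrBE subr0; apply/asboolP; exists x.
Qed.

End SubmoduleChains.

(** * Measures on spaces of polynomials *)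

Section LeastElement.
Implicit Types (E : set nat).

Definition least E : nat :=
  if pselect (exists n, `[< E n >]) is left ex then ex_minn ex else 0%N.

Lemma leastP E n : E n -> E (least E) /\ (least E <= n)%N.
Proof.
move=> En; have En' : `[< E n >] by apply/asboolP.
rewrite /least; case: pselect => [ex|[]]; last by exists n.
by case: ex_minnP => m Em mn; split; [exact/asboolP|exact: mn].
Qed.

Lemma least_mem E n : E n -> E (least E). Proof. by case/leastP. Qed.

Lemma least_le E n : E n -> (least E <= n)%N. Proof. by case/leastP. Qed.

End LeastElement.

Lemma size_sub_lead_coef (R : nzRingType) (p q : {poly R}) :
  p != 0 -> size q = size p -> lead_coef q = lead_coef p ->
  (size (p - q)%R < size p)%N.
Proof.
move=> p0 qp lqp; have s0 : (0 < size p)%N by rewrite size_poly_gt0.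
rewrite -(prednK s0) ltnS; apply/leq_sizeP => j.
rewrite leq_eqVlt => /orP[/eqP<-|]; last first.
  by rewrite prednK// => pj; rewrite coefB !nth_default ?qp// subrr.
by rewrite coefB -lead_coefE -qp -lead_coefE lqp subrr.
Qed.

Section SubspacesByDegree.
Variable K : fieldType.
Implicit Types (W : set {poly K}) (w : {poly K}).

Definition subspace W : Prop :=
  [/\ W 0, forall u v, W u -> W v -> W (u + v) & forall c u, W u -> W (c *: u)].

Definition size_of W (n : nat) : bool := `[< exists2 w, W w & size w = n >].

Definition count_sizes (b : nat) W : nat := (\sum_(n < b.+1) size_of W n)%N.

(** An element of the larger space outside the smaller one, of least degree, has
    a degree that is new: otherwise its leading term could be cancelled. *)
Lemma subspace_new_size W W' : subspace W -> subspace W' -> W `<` W' ->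
  exists n, size_of W' n /\ ~~ size_of W n.
Proof.
move=> [W0 WD WZ] [_ WD' WZ'] [sub nsub].
apply: contrapT => /forallNP nonew; apply: nsub => w.
have [n] := ubnP (size w); elim: n w => // n IH w wn Ww.
have /asboolP[u Wu uw] : size_of W (size w).
  apply: contrapT => /negP nw; apply: (nonew (size w)); split=> //.
  by apply/asboolP; exists w.
have [->//|w0] := eqVneq w 0.
have u0 : u != 0 by rewrite -size_poly_gt0 uw size_poly_gt0.
pose c := lead_coef w / lead_coef u.
rewrite -(subrK (c *: u) w); apply: WD; last exact: WZ.
apply: IH; last by rewrite -scaleNr; apply: WD' => //; exact/WZ'/sub.
rewrite ltnS in wn; apply: leq_trans wn.
have c0 : c != 0 by rewrite mulf_neq0// ?invr_eq0 lead_coef_eq0.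
apply: size_sub_lead_coef => //; first by rewrite size_scale.
by rewrite lead_coefZ divfK// lead_coef_eq0.
Qed.

Lemma count_sizes_le b W : (count_sizes b W <= b.+1)%N.
Proof.
rewrite -[leqRHS]muln1 -[in leqRHS](card_ord b.+1) -sum_nat_const.
by apply: leq_sum => i _; case: size_of.
Qed.

Lemma size_ofS W W' n : W `<=` W' -> (size_of W n <= size_of W' n)%N.
Proof.
move=> sub; have [|//] := boolP (size_of W n) => /asboolP[w Ww wn].
by rewrite lt0b; apply/asboolP; exists w => //; exact: sub.
Qed.

Lemma count_sizesS b W W' : W `<=` W' -> (count_sizes b W <= count_sizes b W')%N.
Proof. by move=> sub; apply: leq_sum => i _; exact: size_ofS. Qed.

(** Sizes above [b] do not distinguish the two subspaces, so the new size given
    by [subspace_new_size] is one of the sizes counted. *)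
Lemma count_sizes_lt b W W' : subspace W -> subspace W' -> W `<` W' ->
  (forall w, W' w -> (b < size w)%N -> size_of W (size w)) ->
  (count_sizes b W < count_sizes b W')%N.
Proof.
move=> sW sW' ltW big; have [n [Wn' Wn]] := subspace_new_size sW sW' ltW.
have nb : (n < b.+1)%N.
  rewrite ltnNge; apply: contra Wn => bn; case/asboolP: Wn' => w Ww wn.
  by rewrite -wn; apply: big; rewrite ?wn.
rewrite /count_sizes (bigD1 (Ordinal nb))//= [ltnRHS](bigD1 (Ordinal nb))//=.
rewrite (negbTE Wn) Wn' add0n add1n ltnS; apply: leq_sum => i _.
by apply: size_ofS; case: ltW.
Qed.

End SubspacesByDegree.

Section OreSubmodules.
Variable K : fieldType.
Hypothesis charK : [pchar K] =i pred0.

Definition shift : {poly K} -> {poly K} := comp_poly ('X + 1).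
HB.instance Definition _ := GRing.RMorphism.copy shift (comp_poly ('X + 1)).

Lemma shiftX : shift 'X = 'X + 1. Proof. exact: comp_polyX. Qed.
Lemma shiftC c : shift c%:P = c%:P. Proof. exact: comp_polyC. Qed.

Lemma horner_shift p x : (shift p).[x] = p.[x + 1].
Proof. by rewrite /shift horner_comp !hornerE. Qed.

Lemma size_XD1 : size ('X + 1 : {poly K}) = 2%N.
Proof. exact: size_XaddC. Qed.

Lemma size_shift p : size (shift p) = size p.
Proof. exact/size_comp_poly2/size_XD1. Qed.

Lemma lead_coef_shift p : lead_coef (shift p) = lead_coef p.
Proof.
rewrite /shift lead_coef_comp ?size_XD1//.
by rewrite (lead_coefXaddC 1) expr1n mulr1.
Qed.

Definition unshift : {poly K} -> {poly K} := comp_poly ('X - 1).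

Lemma unshiftK p : shift (unshift p) = p.
Proof.
by rewrite /shift /unshift -comp_polyA comp_polyB comp_polyX rmorph1 addrK comp_polyXr.
Qed.

Lemma size_unshift p : size (unshift p) = size p.
Proof. by rewrite -[in RHS](unshiftK p) size_shift. Qed.

Lemma lead_coef_unshift p : lead_coef (unshift p) = lead_coef p.
Proof. by rewrite -[in RHS](unshiftK p) lead_coef_shift. Qed.

Lemma natr_neq0 n : n.+1%:R != 0 :> K.
Proof. by rewrite (iffLR (pcharf0P K) charK). Qed.

Lemma natr_inj_char0 : injective (fun n => n%:R : K).
Proof.
suff H m n : (m <= n)%N -> m%:R = n%:R :> K -> m = n.
  by move=> m n e; case/orP: (leq_total m n) => [/H->//|/H H']; apply/esym/H'.
move=> mn /eqP; rewrite eq_sym -subr_eq0 -natrB//.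
by rewrite (iffLR (pcharf0P K) charK) subn_eq0 => nm; apply/eqP; rewrite eqn_leq mn.
Qed.

(** In characteristic zero a nonzero polynomial has finitely many roots among the
    natural numbers. *)
Lemma horner_nat_neq0 (p : {poly K}) : p != 0 ->
  exists n0, forall n, (n0 <= n)%N -> p.[n%:R] != 0.
Proof.
have [m] := ubnP (size p); elim: m p => // m IH p pm p0.
have [[d /eqP pd]|nod] := pselect (exists d : nat, p.[d%:R] = 0); last first.
  by exists 0%N => n _; apply/eqP => pn; apply: nod; exists n.
have /factor_theorem[q pq] : root p d%:R by exact: pd.
have q0 : q != 0 by apply: contra_neq p0; rewrite pq => ->; rewrite mul0r.
have [|//|n1 qn] := IH q.
  by move: pm; rewrite pq size_Mmonic ?monicXsubC// size_XsubC addn2.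
exists (maxn n1 d.+1) => n; rewrite geq_max => /andP[n1n dn].
rewrite pq hornerM mulf_neq0 ?qn//= !hornerE subr_eq0.
by apply/eqP => /natr_inj_char0 nd; rewrite nd ltnn in dn.
Qed.

(** A polynomial fixed by the shift takes the same value at all natural numbers. *)
Lemma unshift_fixed p : unshift p = p -> p = (p.[0])%:P.
Proof.
move=> up; have sp : shift p = p by rewrite -{1}up unshiftK.
have pn n : p.[n%:R] = p.[0].
  by elim: n => // n <-; rewrite -natr1 -horner_shift sp.
apply/eqP; rewrite -subr_eq0; apply/negPn/negP => /horner_nat_neq0[n /(_ n)].
by rewrite leqnn hornerD hornerN hornerC pn subrr eqxx => /(_ isT).
Qed.

(** Left multiplication by [T] in the Ore algebra of the operators
    [\sum_k P_k(H) * T ^+ k], where [T * p(H) = p(H + 1) * T]. *)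
Definition ore_shift (P : {poly {poly K}}) : {poly {poly K}} :=
  map_poly shift P * 'X.

Lemma ore_shiftD P Q : ore_shift (P + Q) = ore_shift P + ore_shift Q.
Proof. by rewrite /ore_shift rmorphD mulrDl. Qed.

Lemma ore_shiftZ p P : ore_shift (p *: P) = shift p *: ore_shift P.
Proof. by rewrite /ore_shift map_polyZ scalerAl. Qed.

Lemma shift_inj : injective shift.
Proof.
move=> p q pq; apply/eqP; rewrite -subr_eq0 -size_poly_eq0 -size_shift.
by rewrite rmorphB /= pq subrr size_poly0.
Qed.

Lemma size_map_shift P : size (map_poly shift P) = size P.
Proof. exact: (size_map_inj_poly shift_inj (rmorph0 _)). Qed.

Lemma size_ore_shift P : P != 0 -> size (ore_shift P) = (size P).+1.
Proof.
move=> P0; rewrite /ore_shift size_mulX ?size_map_shift//.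
by rewrite -size_poly_eq0 size_map_shift size_poly_eq0.
Qed.

Lemma lead_coef_ore_shift P : lead_coef (ore_shift P) = shift (lead_coef P).
Proof.
rewrite /ore_shift lead_coef_Mmonic ?monicX//.
exact: (lead_coef_map_inj shift_inj (rmorph0 _)).
Qed.

(** The last condition makes [T] injective on the quotient by [Q], as if [T] were
    invertible. *)
Definition ore_submodule (Q : set {poly {poly K}}) : Prop :=
  [/\ Q 0, forall P P', Q P -> Q P' -> Q (P + P'),
      forall p P, Q P -> Q (p *: P) & forall P, Q (ore_shift P) <-> Q P].

Lemma ore_submoduleB Q P P' : ore_submodule Q -> Q P -> Q P' -> Q (P - P').
Proof.
by move=> [_ QD QZ _] QP QP'; apply: QD => //; rewrite -scaleN1r; exact: QZ.
Qed.

(** Multiplying by powers of [T] raises the order without changing the size of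
    the leading coefficient. *)
Lemma ore_submodule_raise Q P n : ore_submodule Q -> Q P -> P != 0 ->
  (size P <= n)%N ->
  exists P', [/\ Q P', size P' = n & size (lead_coef P') = size (lead_coef P)].
Proof.
move=> [Q0 QD QZ QS] QP P0; elim: n => [|n IH].
  by rewrite leqn0 size_poly_eq0 (negbTE P0).
rewrite leq_eqVlt => /orP[/eqP Pn|]; first by exists P.
rewrite ltnS => /IH[P' [QP' Pn Pl]]; exists (ore_shift P'); split.
- exact/QS.
- rewrite size_ore_shift ?Pn// -lead_coef_eq0 -size_poly_eq0 Pl.
  by rewrite size_poly_eq0 lead_coef_eq0.
- by rewrite lead_coef_ore_shift size_shift.
Qed.

Definition orders (Q : set {poly {poly K}}) : set nat :=
  [set size P | P in [set P | Q P /\ P <> 0]].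

Definition lead_sizes (Q : set {poly {poly K}}) : set nat :=
  [set size (lead_coef P) | P in [set P | Q P /\ P <> 0]].

Definition ore_measure Q : nat := (least (orders Q) + least (lead_sizes Q))%N.

Section EqualMeasures.
Variables Q Q' : set {poly {poly K}}.
Hypotheses (subQ : ore_submodule Q) (subQ' : ore_submodule Q') (QQ' : Q `<=` Q').
Variable P0 : {poly {poly K}}.
Hypotheses (QP0 : Q P0) (P0_neq0 : P0 <> 0).

Lemma ore_measure_ge :
  (least (orders Q') <= least (orders Q))%N /\
  (least (lead_sizes Q') <= least (lead_sizes Q))%N.
Proof.
split.
  have [P [QP PN] <-] : orders Q (least (orders Q)).
    by apply: (@least_mem _ (size P0)); exists P0.
  by apply: least_le; exists P => //; split=> //; exact: QQ'.
have [P [QP PN] <-] : lead_sizes Q (least (lead_sizes Q)).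
  by apply: (@least_mem _ (size (lead_coef P0))); exists P0.
by apply: least_le; exists P => //; split=> //; exact: QQ'.
Qed.

Hypothesis eq_order : least (orders Q') = least (orders Q).
Hypothesis eq_lead : least (lead_sizes Q') = least (lead_sizes Q).

(** With equal least orders, division by an element of [Q] of least order leaves
    remainder zero, after multiplying by the leading coefficients involved. *)
Lemma ore_torsion P : Q' P -> exists2 p : {poly K}, p != 0 & Q (p *: P).
Proof.
have [P1 [QP1 P1N] P1r] : orders Q (least (orders Q)).
  by apply: (@least_mem _ (size P0)); exists P0.
have [n] := ubnP (size P); elim: n P => // n IH P Pn Q'P.
have [->|PN] := eqVneq P 0.
  by exists 1; rewrite ?oner_neq0// scaler0; case: subQ.
have P1P : (size P1 <= size P)%N.
  rewrite P1r -eq_order; apply: least_le.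
  by exists P => //; split=> //; exact/eqP.
have [P2 [QP2 P2P _]] := ore_submodule_raise subQ QP1 (introN eqP P1N) P1P.
have P2N : P2 != 0 by rewrite -size_poly_eq0 P2P size_poly_eq0.
set a := lead_coef P2; set b := lead_coef P.
have a0 : a != 0 by rewrite lead_coef_eq0.
have b0 : b != 0 by rewrite lead_coef_eq0.
have [||p p0 Qp] := IH (a *: P - b *: P2).
- rewrite ltnS in Pn; apply: leq_trans Pn; rewrite -(size_scale P a0).
  apply: size_sub_lead_coef; rewrite ?size_scale//.
    by rewrite -size_poly_eq0 size_scale// size_poly_eq0.
  by rewrite !lead_coefZ mulrC.
- apply: ore_submoduleB => //; case: (subQ') => _ _ Z _; apply: Z => //; exact: QQ'.
exists (p * a); first by rewrite mulf_neq0.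
have -> : (p * a) *: P = p *: (a *: P - b *: P2) + (p * b) *: P2.
  by rewrite scalerBr !scalerA subrK.
by case: (subQ) => _ QD QZ _; apply: QD => //; exact: QZ.
Qed.

(** The elements of bounded order form a finitely generated module over [K[H]]:
    in each order take one with a leading coefficient of least degree. *)
Lemma ore_uniform_torsion_order n : exists2 p : {poly K}, p != 0 &
  forall P, Q' P -> (size P <= n)%N -> Q (p *: P).
Proof.
elim: n => [|n [p p0 IH]].
  exists 1; rewrite ?oner_neq0// => P _; rewrite leqn0 size_poly_eq0 => /eqP->.
  by rewrite scaler0; case: subQ.
(* The sizes of the leading coefficients in [Q'] of order exactly [n]. *)
pose E := [set size (lead_coef P) | P in [set P | Q' P /\ size P = n.+1]].
have [[m Em]|noE] := pselect (exists m, E m); last first.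
  exists p => // P Q'P; rewrite leq_eqVlt => /orP[/eqP Pn|]; last exact: IH.
  by exfalso; apply: noE; exists (size (lead_coef P)), P.
have [G [Q'G Gn] Gm] := least_mem Em.
have GN : G != 0 by rewrite -size_poly_eq0 Gn.
have [q q0 QqG] := ore_torsion Q'G.
exists (p * q) => [|P Q'P]; first by rewrite mulf_neq0.
rewrite leq_eqVlt => /orP[/eqP Pn|]; last first.
  move=> Pn; rewrite mulrC -scalerA; case: (subQ) => _ _ Z _; apply: Z.
  exact: IH.
have PN : P != 0 by rewrite -size_poly_eq0 Pn.
pose c := lead_coef P %/ lead_coef G.
have lcP := divp_eq (lead_coef P) (lead_coef G).
have Q'D : Q' (P - c *: G).
  by apply: ore_submoduleB => //; case: (subQ') => _ _ Z _; exact: Z.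
have small : (size (P - c *: G)%R <= n)%N.
  apply/leq_sizeP => j; rewrite leq_eqVlt => /orP[/eqP<-|nj]; last first.
    by rewrite coefB coefZ !nth_default ?mulr0 ?subr0 ?Gn ?Pn.
  (* Otherwise the leading coefficient is the remainder of the division by that
     of [G], which is too short. *)
  apply/eqP/negPn/negP => cN.
  have sD : size (P - c *: G)%R = n.+1.
    apply/eqP; rewrite eqn_leq; apply/andP; split; last first.
      by rewrite ltnNge; apply: contra cN => le; rewrite nth_default.
    apply/leq_sizeP => i ni.
    by rewrite coefB coefZ !nth_default ?mulr0 ?subr0 ?Gn ?Pn.
  have /least_le : E (size (P - c *: G)%R`_n).
    by exists (P - c *: G) => //; rewrite lead_coefE sD.
  rewrite -Gm leqNgt => /negP; apply.
  rewrite coefB coefZ.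
  have -> : P`_n = lead_coef P by rewrite lead_coefE Pn.
  have -> : G`_n = lead_coef G by rewrite lead_coefE Gn.
  by rewrite {1}lcP addrC addKr ltn_modp lead_coef_eq0.
have -> : (p * q) *: P = q *: (p *: (P - c *: G)) + (p * c) *: (q *: G).
  by rewrite !scalerBr !scalerA [q * p]mulrC [p * c * q]mulrAC subrK.
by case: (subQ) => _ QD QZ _; apply: QD; apply: QZ => //; exact: IH.
Qed.

(** With equal least degrees of leading coefficients, division by an element of
    [Q] reduces every element of [Q'] to one of bounded order. *)
Lemma ore_uniform_torsion : exists2 p : {poly K}, p != 0 &
  forall P, Q' P -> Q (p *: P).
Proof.
have [G [QG GN] Gs] : lead_sizes Q (least (lead_sizes Q)).
  by apply: (@least_mem _ (size (lead_coef P0))); exists P0.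
have [p p0 Hp] := ore_uniform_torsion_order (size G).
exists p => // P; have [n] := ubnP (size P); elim: n P => // n IH P Pn Q'P.
have [|GP] := leqP (size P) (size G); first exact: Hp.
have PN : P != 0 by rewrite -size_poly_gt0 (leq_trans _ GP).
have [H [QH HP HG]] := ore_submodule_raise subQ QG (introN eqP GN) (ltnW GP).
have HN : H != 0 by rewrite -size_poly_eq0 HP size_poly_eq0.
pose c := lead_coef P %/ lead_coef H.
have lcP := divp_eq (lead_coef P) (lead_coef H).
have [_ QD QZ _] := subQ; have [_ _ QZ' _] := subQ'.
have Q'D : Q' (P - c *: H).
  by apply: ore_submoduleB => //; apply: QZ'; exact: QQ'.
suff small : (size (P - c *: H)%R < size P)%N.
  rewrite -(subrK (c *: H) P) scalerDr; apply: QD; last exact/QZ/QZ.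
  by apply: IH => //; rewrite ltnS in Pn; exact: leq_trans Pn.
have sP0 : (0 < size P)%N by rewrite size_poly_gt0.
(* A leading term that survives is the remainder of the division by [lead_coef H],
   shorter than the least possible. *)
rewrite ltnNge; apply/negP => le.
have sD : size (P - c *: H)%R = size P.
  apply/eqP; rewrite eqn_leq le andbT; apply/leq_sizeP => i Pi.
  by rewrite coefB coefZ !nth_default ?mulr0 ?subr0 ?HP.
have DN : P - c *: H <> 0.
  by move=> D0; move: sD; rewrite D0 size_poly0 => s0; rewrite -s0 in sP0.
have : (size (lead_coef H) <= size (lead_coef (P - c *: H)%R))%N.
  rewrite HG Gs -eq_lead; apply: least_le.
  by exists (P - c *: H).
rewrite leqNgt => /negP; apply.
rewrite [lead_coef (_ - _)]lead_coefE sD coefB coefZ -lead_coefE -HP -lead_coefE.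
by rewrite {1}lcP addrC addKr ltn_modp lead_coef_eq0.
Qed.

(** An annihilator [p(H)] of [Q' / Q] of least degree is constant: as [T] acts
    injectively on [Q' / Q] and [p(H) * T = T * p(H - 1)], the polynomial
    [p(H - 1)] is an annihilator too, and so is [p(H) - p(H - 1)], of lower
    degree. *)
Lemma ore_measure_eq : Q' `<=` Q.
Proof.
pose E := [set size p | p in [set p | p != 0 /\ forall P, Q' P -> Q (p *: P)]].
have [p1 p10 Hp1] := ore_uniform_torsion.
have [p [p0 Hp] pE] : E (least E).
  by apply: (@least_mem _ (size p1)); exists p1.
have [_ QD QZ QS] := subQ; have [_ _ _ QS'] := subQ'.
have Hup P : Q' P -> Q (unshift p *: P).
  by move=> Q'P; apply/QS; rewrite ore_shiftZ unshiftK; apply: Hp; exact/QS'.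
have /unshift_fixed pC : unshift p = p.
  apply/eqP; rewrite eq_sym -subr_eq0; apply/negPn/negP => d0.
  have : E (size (p - unshift p)%R).
    exists (p - unshift p) => //; split=> // P Q'P.
    by rewrite scalerBl; apply: ore_submoduleB; auto.
  move=> /least_le; rewrite -pE leqNgt size_sub_lead_coef ?size_unshift//.
  exact: lead_coef_unshift.
move=> P Q'P; have c0 : p.[0] != 0 by rewrite -polyC_eq0 -pC.
have -> : P = (p.[0])^-1%:P *: (p *: P).
  by rewrite scalerA {2}pC -polyCM mulVf// scale1r.
exact/QZ/Hp.
Qed.

End EqualMeasures.

Lemma ore_measureS Q Q' P : ore_submodule Q -> ore_submodule Q' -> Q `<=` Q' ->
  Q P -> P <> 0 -> (ore_measure Q' <= ore_measure Q)%N.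
Proof.
by move=> sQ sQ' QQ' QP PN; have [? ?] := ore_measure_ge QQ' QP PN; exact: leq_add.
Qed.

Lemma ore_measure_lt Q Q' P : ore_submodule Q -> ore_submodule Q' -> Q `<` Q' ->
  Q P -> P <> 0 -> (ore_measure Q' < ore_measure Q)%N.
Proof.
move=> sQ sQ' [QQ' nQQ'] QP PN; rewrite ltnNge; apply/negP => le; apply: nQQ'.
have [le1 le2] := ore_measure_ge QQ' QP PN.
apply: (ore_measure_eq sQ sQ' QQ' QP PN); apply/eqP; rewrite eqn_leq.
  rewrite le1 /=; move: le; rewrite /ore_measure => le.
  by rewrite -(leq_add2r (least (lead_sizes Q'))) (leq_trans _ le)// leq_add2l.
rewrite le2 /=; move: le; rewrite /ore_measure => le.
by rewrite -(leq_add2l (least (orders Q'))) (leq_trans _ le)// leq_add2r.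
Qed.

End OreSubmodules.

(** * Rings of integro-differential type *)

(** The axioms are stable under reversing products and exchanging [integ_op] and
    [deriv_op]. The element [1 - integ_op * deriv_op] is the projection onto the
    constants, on which [H = coefH 'X] acts as the identity. *)
Record integro_diff (K : fieldType) (A : nzRingType) := IntegroDiff {
  coefH : {rmorphism {poly K} -> A};
  integ_op : A;
  deriv_op : A;
  deriv_integ : deriv_op * integ_op = 1;
  deriv_coefH : forall p, deriv_op * coefH p = coefH (shift p) * deriv_op;
  coefH_integ : forall p, coefH p * integ_op = integ_op * coefH (shift p);
  coefHX_proj : coefH 'X * (1 - integ_op * deriv_op) = 1 - integ_op * deriv_op;
  proj_coefHX : (1 - integ_op * deriv_op) * coefH 'X = 1 - integ_op * deriv_op;
  proj_neq0 : 1 - integ_op * deriv_op <> 0;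
  integro_diff_ind : forall P : A -> Prop,
    (forall u v, P u -> P v -> P (u + v)) ->
    (forall u v, P u -> P v -> P (u * v)) ->
    (forall p, P (coefH p)) -> P integ_op -> P deriv_op -> forall v, P v
}.

Section IntegroDiffTheory.
Variables (K : fieldType) (A : nzRingType) (D : integro_diff K A).
Hypothesis charK : [pchar K] =i pred0.

Local Notation h := (coefH D).
Local Notation S := (integ_op D).
Local Notation T := (deriv_op D).
Local Notation e := (1 - S * T).
Local Notation ore := (@ore_shift K).

Lemma deriv_integX n : T ^+ n * S ^+ n = 1.
Proof.
elim: n => [|n IH]; first by rewrite !expr0 mulr1.
by rewrite exprSr exprS mulrA -(mulrA _ T) deriv_integ mulr1.
Qed.

Lemma deriv_proj : T * e = 0.
Proof. by rewrite mulrBr mulr1 mulrA deriv_integ mul1r subrr. Qed.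

Lemma proj_integ : e * S = 0.
Proof. by rewrite mulrBl mul1r -mulrA deriv_integ mulr1 subrr. Qed.

Lemma constH_central c v : h c%:P * v = v * h c%:P.
Proof.
elim/(integro_diff_ind (i := D)): v => [u v Hu Hv|u v Hu Hv|p||].
- by rewrite mulrDr mulrDl Hu Hv.
- by rewrite mulrA Hu -mulrA Hv mulrA.
- by rewrite -!rmorphM mulrC.
- by rewrite coefH_integ shiftC.
- by rewrite deriv_coefH shiftC.
Qed.

Lemma proj_coefH p : e * h p = e * h (p.[1])%:P.
Proof.
elim/poly_ind: p => [|p c IH]; first by rewrite horner0.
have -> : h (p * 'X + c%:P) = h 'X * h p + h c%:P by rewrite rmorphD mulrC rmorphM.
by rewrite mulrDr mulrA proj_coefHX IH hornerMXaddC mulr1 polyCD rmorphD mulrDr.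
Qed.

(** The operator [\sum_k P_k(H) * T ^+ k]. *)
Definition ore_eval (P : {poly {poly K}}) : A := (map_poly h P).[T].

Lemma ore_eval0 : ore_eval 0 = 0.
Proof. by rewrite /ore_eval rmorph0 horner0. Qed.

Lemma ore_evalD P Q : ore_eval (P + Q) = ore_eval P + ore_eval Q.
Proof. by rewrite /ore_eval rmorphD hornerD. Qed.

Lemma ore_evalZ p P : ore_eval (p *: P) = h p * ore_eval P.
Proof. by rewrite /ore_eval map_polyZ hornerZ. Qed.

Lemma ore_evalMX P : ore_eval (P * 'X) = ore_eval P * T.
Proof. by rewrite /ore_eval rmorphM /= map_polyX hornerMX. Qed.

Lemma ore_evalC p : ore_eval p%:P = h p.
Proof. by rewrite /ore_eval map_polyC hornerC. Qed.

Lemma deriv_ore_eval P : T * ore_eval P = ore_eval (ore P).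
Proof.
elim/poly_ind: P => [|P c IH].
  by rewrite /ore_shift rmorph0 mul0r ore_eval0 mulr0.
rewrite ore_shiftD !ore_evalD mulrDr ore_evalMX mulrA IH ore_evalC deriv_coefH.
rewrite /ore_shift !rmorphM /= map_polyX map_polyC /= !ore_evalMX.
by rewrite ore_evalC.
Qed.

Lemma derivX_ore_eval n P : T ^+ n * ore_eval P = ore_eval (iter n ore P).
Proof.
elim: n => [|n IH]; first by rewrite mul1r.
by rewrite exprS -mulrA IH deriv_ore_eval.
Qed.

Lemma ore_eval_deriv n P : exists P', T ^+ n * ore_eval P = ore_eval P' * T ^+ n.
Proof.
elim: n P => [|n IH] P; first by exists P; rewrite mulr1 mul1r.
rewrite exprSr -mulrA deriv_ore_eval /ore_shift ore_evalMX mulrA.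
by have [P' ->] := IH (map_poly (@shift K) P); exists P'; rewrite mulrA.
Qed.

Lemma ore_evalM P Q : exists P', ore_eval P * ore_eval Q = ore_eval P'.
Proof.
elim/poly_ind: P Q => [|P c IH] Q; first by exists 0; rewrite ore_eval0 mul0r.
rewrite ore_evalD ore_evalMX mulrDl -mulrA deriv_ore_eval ore_evalC.
by have [P' ->] := IH (ore Q); exists (P' + c *: Q); rewrite ore_evalD ore_evalZ.
Qed.

(** Modulo the finite part every element is a Laurent polynomial in [T]; a power
    of [T] clears its poles, and kills its finite part. *)
Lemma left_normal_form v : exists n P, T ^+ n * v = ore_eval P.
Proof.
elim/(integro_diff_ind (i := D)): v => [u v|u v|p||].
- move=> [m [P uP]] [n [Q vQ]].
  exists (m + n)%N, (iter n ore P + iter m ore Q).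
  rewrite mulrDr {1}addnC !exprD -!mulrA uP vQ !derivX_ore_eval.
  by rewrite ore_evalD.
- move=> [m [P uP]] [n [Q vQ]].
  have [P' nP] := ore_eval_deriv n P; have [P'' E] := ore_evalM P' Q.
  by exists (n + m)%N, P''; rewrite exprD mulrA -[_ * u]mulrA uP nP -mulrA vQ.
- by exists 0%N, p%:P; rewrite mul1r ore_evalC.
- by exists 1%N, 1; rewrite deriv_integ -polyC1 ore_evalC rmorph1.
- by exists 0%N, 'X; rewrite mul1r -['X]mul1r ore_evalMX -polyC1 ore_evalC rmorph1 mul1r.
Qed.

(** The matrix with first row [w] and all other rows zero, that is
    [\sum_j w_j * e * T ^+ j]. *)
Definition first_row (w : {poly K}) : A := e * ore_eval (map_poly polyC w).

Lemma first_row0 : first_row 0 = 0.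
Proof. by rewrite /first_row rmorph0 ore_eval0 mulr0. Qed.

Lemma first_rowD u v : first_row (u + v) = first_row u + first_row v.
Proof. by rewrite /first_row rmorphD ore_evalD mulrDr. Qed.

Lemma first_rowB u v : first_row (u - v) = first_row u - first_row v.
Proof. by apply/eqP; rewrite eq_sym subr_eq -first_rowD subrK. Qed.

Lemma first_rowZ c w : first_row (c *: w) = h c%:P * first_row w.
Proof. by rewrite /first_row map_polyZ ore_evalZ !mulrA constH_central. Qed.

Lemma first_rowMX w : first_row (w * 'X) = first_row w * T.
Proof. by rewrite /first_row rmorphM /= map_polyX ore_evalMX mulrA. Qed.

Lemma first_rowMXn w n : first_row (w * 'X^n) = first_row w * T ^+ n.
Proof.
elim: n => [|n IH]; first by rewrite !mulr1.
by rewrite !exprSr mulrA first_rowMX IH mulrA.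
Qed.

Lemma first_rowC c : first_row c%:P = e * h c%:P.
Proof. by rewrite /first_row map_polyC ore_evalC. Qed.

Lemma first_row_integ w c : first_row (w * 'X + c%:P) * S = first_row w.
Proof.
rewrite first_rowD first_rowMX mulrDl -mulrA deriv_integ mulr1 first_rowC -constH_central.
by rewrite -mulrA proj_integ mulr0 addr0.
Qed.

Lemma first_row_integX n (w : {poly K}) : (size w <= n)%N -> first_row w * S ^+ n = 0.
Proof.
elim: n w => [|n IH] w.
  by rewrite leqn0 size_poly_eq0 => /eqP->; rewrite first_row0 mul0r.
elim/poly_ind: w => [|w c _]; first by rewrite first_row0 mul0r.
move=> wn; rewrite exprS mulrA first_row_integ IH//.
move: wn; rewrite size_MXaddC; case: ifP => // /andP[/eqP-> _].
by rewrite size_poly0.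
Qed.

Lemma first_row_eq0 w : first_row w = 0 -> w = 0.
Proof.
elim/poly_ind: w => // w c IH wc0.
have w0 : w = 0 by apply: IH; rewrite -(first_row_integ w c) wc0 mul0r.
move: wc0; rewrite w0 mul0r add0r first_rowC => ec0; have [->//|c0] := eqVneq c 0.
case: (proj_neq0 (i := D)); rewrite -[LHS]mulr1 -[X in _ * X](rmorph1 h).
by rewrite -polyC1 -(mulfV c0) polyCM rmorphM mulrA ec0 mul0r.
Qed.

Lemma first_row_integX_eq0 n w : first_row w * S ^+ n = 0 -> (size w <= n)%N.
Proof.
elim: n w => [|n IH] w; first by rewrite mulr1 => /first_row_eq0->; rewrite size_poly0.
elim/poly_ind: w => [|w c _]; first by rewrite size_poly0.
rewrite exprS mulrA first_row_integ => /IH wn.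
by rewrite size_MXaddC; case: ifP.
Qed.

Lemma proj_ore_eval P :
  e * ore_eval P = first_row (map_poly (horner_eval 1) P).
Proof.
elim/poly_ind: P => [|P c IH]; first by rewrite rmorph0 ore_eval0 mulr0 first_row0.
rewrite rmorphD rmorphM /= map_polyX map_polyC /= ore_evalD ore_evalMX mulrDr.
by rewrite mulrA IH first_rowD first_rowMX ore_evalC first_rowC /horner_eval proj_coefH.
Qed.

(** The rows of all elements are finite; equivalently [e * A] is spanned by the
    [e * T ^+ j]. *)
Lemma first_row_mul w v : exists w', first_row w * v = first_row w'.
Proof.
elim/(integro_diff_ind (i := D)): v w => [u v Hu Hv|u v Hu Hv|p||] w.
- have [w1 w1E] := Hu w; have [w2 w2E] := Hv w.
  by exists (w1 + w2); rewrite mulrDr first_rowD w1E w2E.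
- have [w1 w1E] := Hu w; have [w2 w2E] := Hv w1.
  by exists w2; rewrite mulrA w1E.
- elim/poly_ind: w p => [|w c IH] p; first by exists 0; rewrite first_row0 mul0r.
  have [w1 w1E] := IH (shift p).
  exists (w1 * 'X + (c * p.[1])%:P).
  rewrite !first_rowD !first_rowMX mulrDl -mulrA deriv_coefH mulrA w1E !first_rowC.
  congr (_ + _); rewrite -mulrA constH_central mulrA (proj_coefH p) -mulrA.
  by rewrite polyCM rmorphM constH_central.
- elim/poly_ind: w => [|w c _]; first by exists 0; rewrite first_row0 mul0r.
  by exists w; rewrite first_row_integ.
- by exists (w * 'X); rewrite first_rowMX.
Qed.

(** The ideal [F]: these are the elements with finitely many nonzero rows. *)
Definition finite_part (v : A) : Prop := exists n, T ^+ n * v = 0.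

(** As [e * T ^+ d * p(H) = p(d + 1) * e * T ^+ d], multiplication by [Q(H, T)]
    raises the degree of the row [e * T ^+ d] by the order of [Q] unless [d + 1]
    is a root of its leading coefficient; from [d0] on this does not happen. *)
Lemma first_row_ore_eval_size d0 w (Q : {poly {poly K}}) : w != 0 -> Q != 0 ->
  (forall d, (d0 <= d)%N -> (lead_coef Q).[d.+1%:R] != 0) ->
  exists2 w', first_row (w * 'X^d0) * ore_eval Q = first_row w' &
    size w' = (size w + d0 + (size Q).-1)%N.
Proof.
have iter_size n (R : {poly {poly K}}) : R != 0 ->
    size (iter n ore R) = (n + size R)%N /\
    lead_coef (iter n ore R) = iter n (@shift K) (lead_coef R).
  move=> R0; elim: n => [|n [IH1 IH2]]; first by [].
  split; last by rewrite /= lead_coef_ore_shift IH2.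
  by rewrite /= size_ore_shift ?IH1// -size_poly_gt0 IH1 addn_gt0 size_poly_gt0 R0 orbT.
have monomial (R : {poly {poly K}}) c : R != 0 -> c != 0 ->
    (lead_coef R).[d0.+1%:R] != 0 ->
    exists2 w', first_row (c%:P * 'X^d0) * ore_eval R = first_row w' &
      size w' = (d0 + size R)%N.
  move=> R0 c0 lR; exists (c *: map_poly (horner_eval 1) (iter d0 ore R)).
    rewrite first_rowZ -proj_ore_eval -derivX_ore_eval first_rowMXn first_rowC.
    rewrite -constH_central.
    by rewrite !mulrA.
  have [sR lR'] := iter_size d0 _ R0; rewrite size_scale//.
  rewrite size_map_poly_id0// lR' /horner_eval.
  have -> : forall (n : nat) (p : {poly K}) x, (iter n (@shift K) p).[x] = p.[x + n%:R].
    elim=> [|n IH] p x; first by rewrite addr0.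
    by rewrite /= horner_shift IH -addrA nat1r.
  by rewrite nat1r.
elim/poly_ind: w Q => [|w c IH] Q w0 Q0 lQ; first by rewrite eqxx in w0.
have [w_eq0|wN] := eqVneq w 0.
  move: w0; rewrite w_eq0 mul0r add0r polyC_eq0 => c0.
  have [w' E sw'] := monomial Q c Q0 c0 (lQ _ (leqnn _)).
  exists w' => //; rewrite sw' size_polyC c0 add1n addSnnS.
  by rewrite prednK// size_poly_gt0.
have oQ : ore Q != 0 by rewrite -size_poly_gt0 size_ore_shift.
have [|w1 w1E sw1] := IH (ore Q) wN oQ.
  by move=> d dd; rewrite lead_coef_ore_shift horner_shift natr1 lQ// leqW.
have [u uE su] : exists2 u, first_row (c%:P * 'X^d0) * ore_eval Q = first_row u &
    (size u <= d0 + size Q)%N.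
  have [->|c0] := eqVneq c 0.
    by exists 0; rewrite ?mul0r ?first_row0 ?mul0r// size_poly0.
  have [u uE su] := monomial Q c Q0 c0 (lQ _ (leqnn _)).
  by exists u; rewrite ?su.
exists (w1 + u).
  rewrite [(_ + _) * _]mulrDl mulrAC !first_rowD mulrDl first_rowMX -mulrA deriv_ore_eval.
  by rewrite w1E uE.
have Qs : (0 < size Q)%N by rewrite size_poly_gt0.
have ws : (0 < size w)%N by rewrite size_poly_gt0.
rewrite size_MXaddC (negbTE wN) /= size_polyDl sw1 size_ore_shift//=.
  by rewrite -[in LHS](prednK Qs) addSn addSn addnS.
apply: leq_ltn_trans su _; rewrite -addnA -[ltnLHS]add0n.
by rewrite -addSn leq_add.
Qed.

Lemma first_row_mul_bounded v n : exists b, forall w : {poly K}, (size w <= n)%N ->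
  exists2 w', first_row w * v = first_row w' & (size w' <= b)%N.
Proof.
elim: n => [|n [b IH]].
  exists 0%N => w; rewrite leqn0 size_poly_eq0 => /eqP->.
  by exists 0; rewrite ?first_row0 ?mul0r// size_poly0.
have [u uE] := first_row_mul 'X^n v.
exists (maxn b (size u)) => w wn.
have [|w1 w1E sw1] := IH (w - w`_n *: 'X^n).
  apply/leq_sizeP => j; rewrite leq_eqVlt coefB coefZ coefXn => /orP[/eqP<-|nj].
    by rewrite eqxx mulr1 subrr.
  by rewrite gtn_eqF// mulr0 subr0 nth_default// (leq_trans wn).
exists (w1 + w`_n *: u).
  have -> : first_row w = first_row (w - w`_n *: 'X^n) + first_row (w`_n *: 'X^n).
    by rewrite -first_rowD subrK.
  by rewrite mulrDl w1E first_rowD !first_rowZ -mulrA uE.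
rewrite (leq_trans (size_polyD _ _))// geq_max !leq_max sw1 /=.
by rewrite size_scale_leq orbT.
Qed.

(** Up to a power [T ^+ l], the element [a] is an operator of some order [m], which
    shifts the degrees of long rows by [m - l]. *)
Lemma first_row_mul_size a : ~ finite_part a -> exists n0 l m, forall w : {poly K},
  (n0 < size w)%N ->
  exists2 w', first_row w * a = first_row w' & (size w' + l = size w + m)%N.
Proof.
move=> aN; have [l [Q lQ]] := left_normal_form a.
have Q0 : Q != 0.
  by apply/eqP => Q0; apply: aN; exists l; rewrite lQ Q0 ore_eval0.
have [|d0 Hd] := horner_nat_neq0 charK (p := lead_coef Q); first by rewrite lead_coef_eq0.
(* Only the part of [w] of degree at least [d0 + l] is controlled by
   [first_row_ore_eval_size]; [b] bounds the contribution of the rest. *)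
have [b Hb] := first_row_mul_bounded a (d0 + l).
exists (d0 + l + b)%N, l, (size Q).-1 => w wb.
set w1 := drop_poly (d0 + l) w.
have sw1 : size w1 = (size w - (d0 + l))%N by rewrite size_drop_poly.
have w1N : w1 != 0.
  by rewrite -size_poly_gt0 sw1 subn_gt0 (leq_ltn_trans _ wb)// leq_addr.
have [|u uE su] := first_row_ore_eval_size (d0 := d0) w1N Q0.
  by move=> d dd; apply: Hd; exact: leqW.
have [|u0 u0E su0] := Hb (take_poly (d0 + l) w); first exact: size_take_poly.
have wl : (d0 + l <= size w)%N by rewrite (leq_trans _ (ltnW wb))// leq_addr.
exists (u + u0).
  rewrite -{1}(poly_take_drop (d0 + l) w) addrC !first_rowD mulrDl u0E exprD mulrA.
  by rewrite [first_row (_ * 'X^l)]first_rowMXn -mulrA lQ uE.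
rewrite size_polyDl; last first.
  apply: leq_ltn_trans su0 _; rewrite su sw1.
  apply: leq_trans (leq_addr _ _); apply: leq_trans (leq_addr _ _).
  by rewrite ltn_subRL.
rewrite su sw1 addnAC; congr addn.
by rewrite -addnA subnK.
Qed.

Lemma first_row_deriv_finite a : finite_part a ->
  exists n, forall d, (n <= d)%N -> first_row 'X^d * a = 0.
Proof.
move=> [n an]; exists n => d nd.
by rewrite -(subnK nd) exprD first_rowMXn -mulrA an mulr0.
Qed.

(** Two degree shifts compose to a degree shift, so that [b * a] cannot kill all
    long rows when neither factor is in the finite part. *)
Lemma finite_partM a b : finite_part (b * a) -> finite_part b \/ finite_part a.
Proof.
move=> ba; case: (pselect (finite_part b)) => [|bN]; first by left.
right; apply: contrapT => aN.
have [n1 [l1 [m1 H1]]] := first_row_mul_size bN.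
have [n2 [l2 [m2 H2]]] := first_row_mul_size aN.
have [n Hn] := first_row_deriv_finite ba.
pose d := (n + n1 + n2 + l1 + l2)%N.
have [|w1 w1E sw1] := H1 'X^d; first by rewrite size_polyXn /d; lia.
rewrite size_polyXn in sw1.
have [|w2 w2E sw2] := H2 w1; first by move: sw1; rewrite /d; lia.
have /first_row_eq0 w20 : first_row w2 = 0.
  by rewrite -w2E -w1E -mulrA Hn// /d; lia.
by move: sw2; rewrite w20 size_poly0; move: sw1; rewrite /d; lia.
Qed.

Lemma ore_eval_finite_part P : finite_part (ore_eval P) -> P = 0.
Proof.
move=> /first_row_deriv_finite[n Hn]; apply/eqP/negPn/negP => P0.
have [|d0 Hd] := horner_nat_neq0 charK (p := lead_coef P); first by rewrite lead_coef_eq0.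
have Xn0 : 'X^n != 0 :> {poly K} by rewrite monic_neq0 ?monicXn.
have [|w wE sw] := first_row_ore_eval_size (d0 := d0) Xn0 P0.
  by move=> d dd; apply: Hd; exact: leqW.
have /first_row_eq0 w0 : first_row w = 0 by rewrite -wE -exprD Hn// leq_addr.
by move: sw; rewrite w0 size_poly0 size_polyXn.
Qed.

Lemma finite_part_mull a c : finite_part a -> finite_part (c * a).
Proof.
move=> [n an]; have [k [P kP]] := left_normal_form c.
have [P' nP] := ore_eval_deriv n P.
by exists (n + k)%N; rewrite exprD mulrA -[_ * c]mulrA kP nP -mulrA an mulr0.
Qed.

Lemma finite_partD a b : finite_part a -> finite_part b -> finite_part (a + b).
Proof.
move=> [m am] [n bn]; exists (m + n)%N.
by rewrite mulrDr {1}addnC !exprD -!mulrA am bn !mulr0 addr0.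
Qed.

Lemma finite_partXN n : ~ finite_part (T ^+ n).
Proof.
move=> [k]; rewrite -exprD => /(congr1 (fun x => x * S ^+ (k + n))).
by rewrite deriv_integX mul0r => /eqP; rewrite oner_eq0.
Qed.

Lemma sum_integ_proj_deriv n v :
  v = S ^+ n * (T ^+ n * v) + \sum_(i < n) S ^+ i * (e * (T ^+ i * v)).
Proof.
elim: n => [|n IH]; first by rewrite !mul1r big_ord0 addr0.
rewrite {1}IH big_ord_recr /= [X in _ = _ + X]addrC addrA; congr (_ + _).
by rewrite mulrBl mulrBr mul1r exprSr exprS !mulrA subrKC.
Qed.

(** Elements of the finite part are finite matrices, so that they are killed by
    powers of [S] on the right as well. *)
Lemma finite_part_integ v : finite_part v -> exists n, v * S ^+ n = 0.
Proof.
move=> [n vn]; rewrite (sum_integ_proj_deriv n v) vn mulr0 add0r.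
suff H m : exists k, forall i, (i < m)%N -> e * (T ^+ i * v) * S ^+ k = 0.
  have [k Hk] := H n; exists k; rewrite mulr_suml big1// => i _.
  by rewrite -mulrA Hk ?mulr0.
elim: m => [|m [k Hk]]; first by exists 0%N.
have [w wE] := first_row_mul 'X^m v.
exists (k + size w)%N => i; rewrite ltnS leq_eqVlt => /orP[/eqP->|/Hk Hi].
  rewrite addnC exprD mulrA [e * _]mulrA -[e * T ^+ m](_ : first_row 'X^m = _).
    by rewrite wE first_row_integX ?mul0r.
  by rewrite -['X^m]mul1r first_rowMXn (first_rowC 1) !rmorph1 mulr1.
by rewrite exprD mulrA Hi mul0r.
Qed.

Local Notation left_ideal := (@submodule A A^o).

Lemma left_idealM (N : set A) c v : left_ideal N -> N v -> N (c * v).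
Proof. by case=> _ _ H /H; apply. Qed.

Lemma left_idealD (N : set A) u v : left_ideal N -> N u -> N v -> N (u + v).
Proof. by case=> _ H _; exact: H. Qed.

Definition row_space (N : set A) : set {poly K} := [set w | N (first_row w)].

(** Multiplication by powers of [T] kills the finite part, so this space depends
    only on [N] modulo the finite part. *)
Definition ore_space (N : set A) : set {poly {poly K}} :=
  [set P | exists n, N (T ^+ n * ore_eval P)].

Lemma row_space_subspace N : left_ideal N -> subspace (row_space N).
Proof.
move=> iN; split=> [|u v|c u]; rewrite /row_space /=.
- by rewrite first_row0; case: iN.
- by rewrite first_rowD; exact: left_idealD.
- by rewrite first_rowZ; exact: left_idealM.
Qed.

Lemma ore_spaceW N n k P : left_ideal N -> N (T ^+ n * ore_eval P) ->
  N (T ^+ (n + k) * ore_eval P).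
Proof. by move=> iN NP; rewrite addnC exprD -mulrA; exact: left_idealM. Qed.

Lemma ore_space_submodule N : left_ideal N -> ore_submodule (ore_space N).
Proof.
move=> iN; split=> [|P Q [m NP] [n NQ]|p P [n NP]|P].
- by exists 0%N; rewrite ore_eval0 mulr0; case: iN.
- exists (m + n)%N; rewrite ore_evalD mulrDr; apply: left_idealD => //.
    exact: ore_spaceW.
  by rewrite addnC; exact: ore_spaceW.
- exists n; rewrite ore_evalZ; move: NP.
  have [q ->] : exists q, T ^+ n * (h p * ore_eval P) = h q * (T ^+ n * ore_eval P).
    elim: n p P => [|n IH] p P; first by exists p; rewrite !mul1r.
    rewrite exprSr -!mulrA [T * (h p * _)]mulrA deriv_coefH -mulrA deriv_ore_eval.
    exact: IH.
  by move=> NP; exact: left_idealM.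
- split=> -[n NP]; last exists n.
    by exists n.+1; rewrite exprSr -mulrA deriv_ore_eval.
  by rewrite -deriv_ore_eval mulrA -exprSr exprS -mulrA; exact: left_idealM.
Qed.

(** Since [v = S * T * v + e * v], membership in a left ideal can be tested on
    the rows [e * T ^+ i * v] and on [T ^+ n * v] for one large [n]. *)
Lemma left_ideal_spaces (N N' : set A) : left_ideal N -> left_ideal N' ->
  row_space N' `<=` row_space N -> ore_space N' `<=` ore_space N -> N' `<=` N.
Proof.
move=> iN iN' rows ores v N'v.
(* A power of [T] brings [v] into [N]; then descend by [v = S * (T * v) + e * v]. *)
have [n [P nP]] := left_normal_form v.
have [k] : ore_space N P.
  by apply: ores; exists 0%N; rewrite mul1r -nP; exact: left_idealM.
rewrite -nP mulrA -exprD; move: (k + n)%N => m {n k P nP}.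
elim: m v N'v => [|m IH] v N'v; first by rewrite mul1r.
rewrite exprSr -mulrA => /IH NTv.
have -> : v = S * (T * v) + e * v by rewrite mulrBl mul1r mulrA subrKC.
apply: left_idealD => //.
  by apply: left_idealM => //; apply: NTv; exact: left_idealM.
have [w wE] := first_row_mul 1 v.
have ewE : e * v = first_row w by rewrite -wE (first_rowC 1) !rmorph1 mulr1.
by rewrite ewE; apply: rows; rewrite /row_space /= -ewE; exact: left_idealM.
Qed.

(** The measure of a left ideal adds the number of small degrees of its rows to
    the drop of [ore_measure]. The zero space of operators has infinite colength,
    whence the alternative: the spaces of operators are all nonzero or all zero. *)
Lemma finite_between_left_ideals (lo hi : set A) b : left_ideal lo ->
  (forall w, hi (first_row w) -> (b < size w)%N -> size_of (row_space lo) (size w)) ->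
  (exists2 P, ore_space lo P & P <> 0) \/ (forall P, ore_space hi P -> P = 0) ->
  @finite_between A A^o lo hi.
Proof.
move=> ilo rows ores.
pose ob := ore_measure (ore_space lo).
pose mu N := (count_sizes b (row_space N) + (ob - ore_measure (ore_space N)))%N.
have spS (N N' : set A) : N `<=` N' ->
    row_space N `<=` row_space N' /\ ore_space N `<=` ore_space N'.
  by move=> sub; split=> [w|P [n NP]]; [exact: sub|exists n; exact: sub].
apply: (@finite_between_measure A A^o lo hi mu (b.+1 + ob)%N) => [N _ _ _|].
  by apply: leq_add (count_sizes_le _ _) _; exact: leq_subr.
move=> N N' iN iN' loN hiN' NN'; have [sub nsub] := NN'.
have [subr subo] := spS _ _ sub.
have oreN : ore_space N `<` ore_space N' -> exists2 P, ore_space lo P & P <> 0.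
  move=> [_ no]; case: ores => // hi0; exfalso; apply: no => P NP.
  rewrite (hi0 P); last exact: (spS _ _ hiN').2.
  by case: (ore_space_submodule iN).
have ore_le (M : set A) : left_ideal M -> lo `<=` M ->
    (exists2 P, ore_space lo P & P <> 0) -> (ore_measure (ore_space M) <= ob)%N.
  move=> iM loM [P loP PN]; apply: ore_measureS loP PN; [exact: ore_space_submodule..|].
  exact: (spS _ _ loM).2.
have [oeq|/eqP oneq] := eqVneq (ore_space N') (ore_space N).
  rewrite /mu oeq ltn_add2r; apply: count_sizes_lt; [exact: row_space_subspace..| |].
    split=> // rows'; apply: nsub; apply: left_ideal_spaces => //.
    by rewrite oeq.
  move=> w N'w wb; have /asboolP[u lou uw] := rows w (hiN' _ N'w) wb.
  by apply/asboolP; exists u => //; exact: (spS _ _ loN).1.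
have olt : ore_space N `<` ore_space N'.
  by split=> // os; apply: oneq; apply/seteqP.
have [P loP PN] := oreN olt.
rewrite /mu -addnS leq_add//; first exact: count_sizesS.
have NP : ore_space N P by exact: (spS _ _ loN).2.
have lt := ore_measure_lt charK (ore_space_submodule iN) (ore_space_submodule iN') olt NP PN.
have : (ore_measure (ore_space N) <= ob)%N by apply: ore_le => //; exists P.
by move: lt; lia.
Qed.

Lemma left_ideal0 : left_ideal [set 0].
Proof.
split=> [//|x y -> ->|c x ->]; first by rewrite /= addr0.
by rewrite /= scaler0.
Qed.

Lemma first_row_derivB1 w : first_row w * (T - 1) = first_row (w * ('X - 1)).
Proof.
by rewrite !mulrBr !mulr1 first_rowB first_rowMX.
Qed.

Lemma derivB1_not_finite : ~ finite_part (T - 1).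
Proof.
move=> /first_row_deriv_finite[n /(_ n (leqnn n))].
rewrite first_row_derivB1 => /first_row_eq0/eqP.
by rewrite mulf_eq0 expf_eq0 polyX_eq0 andbF polyXsubC_eq0.
Qed.

(** At [T = 1] the row [e * T ^+ n = e * T ^+ n * c * (T - 1)] would vanish. *)
Lemma derivB1_no_left_inverse c : ~ finite_part (1 - c * (T - 1)).
Proof.
move=> /first_row_deriv_finite[n /(_ n (leqnn n))] /eqP.
rewrite mulrBr mulr1 subr_eq0 mulrA => /eqP.
have [w ->] := first_row_mul 'X^n c; rewrite first_row_derivB1 => E.
have /first_row_eq0 : first_row ('X^n - w * ('X - 1)) = 0.
  by rewrite first_rowB E subrr.
move=> /(congr1 (horner^~ 1)); rewrite !hornerE expr1n subrr mulr0 subr0.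
by move/eqP; rewrite oner_eq0.
Qed.

Lemma finite_part_derivB1X a n : ~ finite_part a -> ~ finite_part ((T - 1) ^+ n * a).
Proof.
move=> aN; elim: n => [|n IH]; first by rewrite mul1r.
by rewrite exprS -mulrA => /finite_partM[]//; exact: derivB1_not_finite.
Qed.

(** Modulo any left ideal inside the finite part, the left ideals
    [A * (T - 1) ^+ n * a] decrease strictly. *)
Lemma infinite_between_left_ideals (lo hi G : set A) a :
  left_ideal G -> left_ideal hi -> G `<=` finite_part ->
  lo `<=` G -> G `<=` hi -> hi a -> ~ finite_part a ->
  ~ @finite_between A A^o lo hi.
Proof.
move=> iG ihi GF loG Ghi hia aN [b Hb].
(* The increasing chain [I (b.+1)], ..., [I 0] has [b.+1] steps. *)
pose I k : set A := [set v | exists c, G (v - c * ((T - 1) ^+ k * a))].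
suff /Hb : @chain_between A A^o lo hi b.+1 by rewrite ltnn.
exists (fun i => I (b.+1 - i)%N); split=> [i|i ib].
  set k := (_ - _)%N; split.
  - split=> [|u v [c Gu] [d Gv]|d u [c Gu]].
    + by exists 0; rewrite mul0r subr0; case: iG.
    + exists (c + d); rewrite mulrDl opprD addrACA; exact: left_idealD.
    + exists (d * c); rewrite -mulrA -[d *: u]/(d * u) -mulrBr; exact: left_idealM.
  - by move=> v lov; exists 0; rewrite mul0r subr0; exact: loG.
  - move=> v [c Gv]; rewrite -(subrK (c * ((T - 1) ^+ k * a)) v).
    apply: left_idealD => //; first exact: Ghi.
    by apply: left_idealM => //; exact: left_idealM.
have -> : (b.+1 - i)%N = (b.+1 - i.+1).+1 by rewrite subnSK.
move: (_ - _)%N => k; split=> [v [c Gv]|].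
  by exists (c * (T - 1)); rewrite -mulrA [(T - 1) * _]mulrA -exprS.
move=> /(_ ((T - 1) ^+ k * a))[|c /GF].
  by exists 1; rewrite mul1r subrr; case: iG.
rewrite exprS -mulrA mulrA -{1}[_ * a]mul1r -mulrBl => /finite_partM[].
  exact: derivB1_no_left_inverse.
exact: finite_part_derivB1X.
Qed.

Section RightMultiplication.
Variables (a : A) (f : {linear A^o -> A^o}).
Hypothesis fE : forall b : A, f b = b * a.

Lemma im_left_ideal : left_ideal (range f).
Proof.
by apply: submodule_image; split.
Qed.

Lemma ker_left_ideal : left_ideal [set b | f b = 0].
Proof. exact: (submodule_preimage f left_ideal0). Qed.

Lemma finite_part_left_ideal : left_ideal finite_part.
Proof.
split=> [|u v|c u]; [by exists 0%N; rewrite mulr0|exact: finite_partD|].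
exact: finite_part_mull.
Qed.

Lemma mlength_ker_right_mul : (mlength (ker f) < +oo)%E <-> ~ finite_part a.
Proof.
rewrite mlength_ker; split=> [fin [n an]|aN].
  have fn : f (T ^+ n) = 0 by rewrite fE.
  apply: (infinite_between_left_ideals left_ideal0 ker_left_ideal _ _ _ fn) fin => //.
  - by move=> _ ->; exists 0%N; rewrite mulr0.
  - by move=> _ ->; rewrite /= linear0.
  - exact: finite_partXN.
have [n0 [l [m H]]] := first_row_mul_size aN.
apply: (finite_between_left_ideals (b := (n0 + l)%N) left_ideal0).
  move=> w; rewrite /= fE => wa wb.
  have [|u uE] := H w; first exact: leq_ltn_trans (leq_addr _ _) wb.
  have /first_row_eq0 -> : first_row u = 0 by rewrite -uE.
  by rewrite size_poly0; set s := size w in wb *; lia.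
right=> P [k]; rewrite /= fE => Pa.
apply: ore_eval_finite_part; have [] // : finite_part (T ^+ k * ore_eval P) \/ finite_part a.
  by apply: finite_partM; exists 0%N; rewrite Pa mulr0.
by move=> [n E]; exists (n + k)%N; rewrite exprD -mulrA.
Qed.

Lemma mlength_coker_right_mul : (mlength (coker f) < +oo)%E <-> ~ finite_part a.
Proof.
rewrite mlength_coker; split=> [fin aF|aN].
  apply: (infinite_between_left_ideals (G := finite_part) (a := 1)) fin => //.
  - exact: finite_part_left_ideal.
  - by move=> _ [c _ <-]; rewrite fE; exact: finite_part_mull.
  - by rewrite -(expr0 T); exact: finite_partXN.
have [n0 [l [m H]]] := first_row_mul_size aN.
apply: (finite_between_left_ideals (b := (n0 + m)%N) im_left_ideal) => [w _ wb|].
  have [|u uE su] := H 'X^((size w + l - m).-1); first by rewrite size_polyXn; lia.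
  apply/asboolP; exists u; last by move: su; rewrite size_polyXn; lia.
  by exists (first_row 'X^((size w + l - m).-1)); rewrite // fE.
left; have [n [P nP]] := left_normal_form a; exists P.
  by exists 0%N; rewrite mul1r -nP; exists (T ^+ n).
by move=> P0; apply: aN; exists n; rewrite nP P0 ore_eval0.
Qed.

Lemma mlength_im_right_mul : (mlength (im f) < +oo)%E <-> finite_part a.
Proof.
rewrite mlength_im; split=> [fin|aF].
  apply: contrapT => aN; move: fin.
  apply: (infinite_between_left_ideals left_ideal0 im_left_ideal _ _ _ _ aN) => //.
  - by move=> _ ->; exists 0%N; rewrite mulr0.
  - by move=> _ ->; exists 0; rewrite ?linear0.
  - by exists 1; rewrite // fE mul1r.
have [n an] := finite_part_integ aF.
apply: (finite_between_left_ideals (b := n) left_ideal0) => [w [c _ ]|].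
  rewrite fE => cw; rewrite ltnNge => /negP[]; apply: first_row_integX_eq0.
  by rewrite -cw -mulrA an mulr0.
right=> P [k [c _]]; rewrite fE => cP; apply: ore_eval_finite_part.
have [m E] : finite_part (T ^+ k * ore_eval P).
  by rewrite -cP; exact: finite_part_mull.
by exists (m + k)%N; rewrite exprD -mulrA.
Qed.

End RightMultiplication.

End IntegroDiffTheory.

(** * Exchanging differentiation and integration *)

Section Converse.
Variables (K : fieldType) (A : nzRingType) (D : integro_diff K A).

Definition coefH_converse (p : {poly K}) : A^c := coefH D p.

Fact coefH_converse_additive : zmod_morphism coefH_converse.
Proof. by move=> p q; exact: (rmorphB (coefH D)). Qed.
HB.instance Definition _ :=
  GRing.isZmodMorphism.Build {poly K} A^c coefH_converse coefH_converse_additive.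

Fact coefH_converse_multiplicative : monoid_morphism coefH_converse.
Proof.
by split=> [|p q]; [exact: (rmorph1 (coefH D))|rewrite mulrC; exact: (rmorphM (coefH D))].
Qed.
HB.instance Definition _ :=
  GRing.isMonoidMorphism.Build {poly K} A^c coefH_converse
    coefH_converse_multiplicative.

Definition integro_diff_converse : integro_diff K A^c.
Proof.
refine (@IntegroDiff K A^c coefH_converse (deriv_op D) (integ_op D) _ _ _ _ _ _ _).
- exact: (deriv_integ D).
- by move=> p; exact: (coefH_integ D).
- by move=> p; exact: (deriv_coefH D).
- exact: (proj_coefHX D).
- exact: (coefHX_proj D).
- exact: (proj_neq0 (i := D)).
- move=> P PD PM Ph PT PS v.
  by apply: (integro_diff_ind (i := D)) => // u w Pu Pw; exact: PM.
Defined.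

Lemma converse_exp (x : A) n : (x : A^c) ^+ n = x ^+ n.
Proof. by elim: n => // n IH; rewrite exprS exprSr IH. Qed.

(** Finite matrices have both finitely many rows and finitely many columns. *)
Lemma finite_part_converse (charK : [pchar K] =i pred0) v :
  finite_part integro_diff_converse v <-> finite_part D v.
Proof.
split=> [/finite_part_integ[n vn]|/finite_part_integ[n vn]]; exists n.
  by rewrite -converse_exp.
by rewrite converse_exp.
Qed.

End Converse.

Section LeftMultiplication.
Variables (K : fieldType) (A : nzRingType) (D : integro_diff K A) (a : A).
Hypothesis charK : [pchar K] =i pred0.
Local Notation D' := (integro_diff_converse D).

Lemma left_mul_converse (b : A^c) : left_mul a b = b * (a : A^c).
Proof. by []. Qed.

(** Right modules are left modules over the converse ring, where [b |-> a * b]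
    becomes a right multiplication. *)
Lemma mlength_ker_left_mul :
  (mlength (ker (@left_mul A a)) < +oo)%E <-> ~ finite_part D' a.
Proof. exact: (mlength_ker_right_mul D' charK left_mul_converse). Qed.

Lemma mlength_coker_left_mul :
  (mlength (coker (@left_mul A a)) < +oo)%E <-> ~ finite_part D' a.
Proof. exact: (mlength_coker_right_mul D' charK left_mul_converse). Qed.

Lemma mlength_im_left_mul :
  (mlength (im (@left_mul A a)) < +oo)%E <-> finite_part D' a.
Proof. exact: (mlength_im_right_mul D' charK left_mul_converse). Qed.

End LeftMultiplication.

(** * The algebra of polynomial integro-differential operators *)

Section Concrete.
Variable K : fieldType.
Hypothesis charK : [pchar K] =i pred0.
Local Notation I := (I1 K).

Lemma I1P (u v : I) : val u =1 val v -> u = v.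
Proof. by move=> uv; apply/val_inj/endoP. Qed.

Definition I1_H : I := I1_deriv K * I1_x K.

Lemma I1_deriv_integ : I1_deriv K * I1_integ K = 1.
Proof.
apply: I1P => p; apply/polyP => i.
change ((integ p)^`()`_i = p`_i).
rewrite coef_deriv coef_integ /= -[LHS]mulr_natr divfK//.
exact: natr_neq0.
Qed.

Lemma I1_derivH : I1_deriv K * I1_H = (I1_H + 1) * I1_deriv K.
Proof.
apply: I1P => p.
change (('X * p)^`()^`() = ('X * p^`())^`() + p^`()).
by rewrite derivM derivX mul1r derivD addrC.
Qed.

Lemma coef_derivXM (p : {poly K}) i : ('X * p)^`()`_i = p`_i *+ i.+1.
Proof. by rewrite coef_deriv mulrC coefMX. Qed.

Lemma I1_H_integ : I1_H * I1_integ K = I1_integ K * (I1_H + 1).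
Proof.
apply: I1P => p.
change (('X * integ p)^`() = integ (('X * p)^`() + p)).
apply/polyP => i; rewrite coef_derivXM !coef_integ coefD coef_derivXM.
case: i => [|i]; first by rewrite invr0 !mulr0 mul0rn.
by rewrite /= -mulrSr mulrnAl.
Qed.

Lemma I1_integH : I1_integ K * I1_H = I1_x K.
Proof.
apply: I1P => p; change (integ (('X * p)^`()) = 'X * p).
apply/polyP => -[|i]; rewrite coef_integ coef_derivXM coefXM.
  by rewrite invr0 mulr0.
by rewrite /= -[_ *+ i.+1]mulr_natr mulfK// natr_neq0.
Qed.

Lemma I1_proj_coef (p : {poly K}) :
  (val (1 - I1_integ K * I1_deriv K) : endo K) p = (p`_0)%:P.
Proof.
change (p - integ p^`() = (p`_0)%:P); apply/polyP => -[|i].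
  by rewrite coefB coef_integ invr0 mulr0 subr0 coefC.
rewrite coefB coef_integ coef_deriv coefC /= -[p`_i.+1 *+ i.+1]mulr_natr mulfK ?subrr//.
exact: natr_neq0.
Qed.

Lemma I1_proj_neq0 : 1 - I1_integ K * I1_deriv K <> 0.
Proof.
move=> /(congr1 (fun v : I => (val v : endo K) 1)); rewrite I1_proj_coef.
by move=> /eqP; rewrite coef1 /= polyC_eq0 oner_eq0.
Qed.

Lemma I1_H_proj :
  I1_H * (1 - I1_integ K * I1_deriv K) = 1 - I1_integ K * I1_deriv K.
Proof.
apply: I1P => p; rewrite I1_proj_coef.
change (('X * ((val (1 - I1_integ K * I1_deriv K) : endo K) p))^`() = (p`_0)%:P).
by rewrite I1_proj_coef derivM derivX derivC mul1r mulr0 addr0.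
Qed.

Lemma I1_proj_H :
  (1 - I1_integ K * I1_deriv K) * I1_H = 1 - I1_integ K * I1_deriv K.
Proof.
apply: I1P => p; rewrite I1_proj_coef.
change ((val (1 - I1_integ K * I1_deriv K) : endo K) ('X * p)^`() = (p`_0)%:P).
by rewrite I1_proj_coef coef_derivXM.
Qed.

Definition I1_coefH : {poly K} -> I := horner_alg I1_H.
HB.instance Definition _ := GRing.RMorphism.copy I1_coefH (horner_alg I1_H).

Lemma I1_coefHX : I1_coefH 'X = I1_H. Proof. exact: horner_algX. Qed.

Lemma I1_coefHC c : I1_coefH c%:P = c *: 1. Proof. exact: horner_algC. Qed.

Lemma I1_deriv_coefH p :
  I1_deriv K * I1_coefH p = I1_coefH (shift p) * I1_deriv K.
Proof.
elim/poly_ind: p => [|p c IH]; first by rewrite !rmorph0 mulr0 mul0r.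
rewrite !rmorphD !rmorphM /= shiftX shiftC mulrDr mulrA IH mulrDl.
rewrite rmorphD rmorph1 /= !I1_coefHX -!mulrA I1_derivH I1_coefHC.
by rewrite -scalerAr -scalerAl mulr1 mul1r.
Qed.

Lemma I1_coefH_integ p :
  I1_coefH p * I1_integ K = I1_integ K * I1_coefH (shift p).
Proof.
elim/poly_ind: p => [|p c IH]; first by rewrite !rmorph0 mulr0 mul0r.
rewrite !rmorphD !rmorphM /= shiftX shiftC mulrDl -mulrA I1_coefHX I1_H_integ.
rewrite [I1_coefH p * _]mulrA IH [RHS]mulrDr rmorphD rmorph1 /= !I1_coefHX -!mulrA I1_coefHC.
by rewrite -scalerAr -scalerAl mulr1 mul1r.
Qed.

(** The generator [x] is [S * H], and scalars are constant polynomials in [H]. *)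
Lemma I1_ind (P : I -> Prop) :
  (forall u v, P u -> P v -> P (u + v)) ->
  (forall u v, P u -> P v -> P (u * v)) ->
  (forall p, P (I1_coefH p)) -> P (I1_integ K) -> P (I1_deriv K) -> forall v, P v.
Proof.
move=> PD PM Ph PS PT [f fI].
pose B (g : endo K) := `[< exists2 v : I, P v & val v = g >].
have Bclosed : GRing.subsemialg_closed B.
  have BZ c g : B g -> B (c *: g).
    move=> /asboolP[v Pv <-]; apply/asboolP; exists (I1_coefH c%:P * v); auto.
    by rewrite I1_coefHC -scalerAl mul1r.
  split=> [||//|u v /asboolP[u' Pu <-] /asboolP[v' Pv <-]].
  - by apply/asboolP; exists 1; rewrite // -(rmorph1 I1_coefH).
  - split=> [|u v /asboolP[u' Pu <-] /asboolP[v' Pv <-]]; apply/asboolP.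
      by exists 0; rewrite // -(rmorph0 I1_coefH).
    by exists (u' + v'); auto.
  - by apply/asboolP; exists (u' * v'); auto.
pose Bm := GRing.isSubalgClosed.Build K (endo K) B Bclosed.
pose Bs : subalgClosed (endo K) := HB.pack (B : {pred endo K}) Bm.
have gB : @I1_gens K `<=` [set` Bs].
  move=> g [[->|->]|->]; apply/asboolP.
  - exists (I1_x K) => //; rewrite -I1_integH -I1_coefHX; auto.
  - by exists (I1_deriv K).
  - by exists (I1_integ K).
have /asboolP[v Pv vf] : f \in (Bs : {pred endo K}) by move/asboolP: (fI); apply.
by rewrite (_ : exist _ f fI = v)//; apply/val_inj.
Qed.

Definition I1_integro_diff : integro_diff K I :=
  IntegroDiff I1_deriv_integ I1_deriv_coefH I1_coefH_integ
    (etrans (congr1 (fun u => u * _) I1_coefHX) I1_H_proj)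
    (etrans (congr1 (fun u => _ * u) I1_coefHX) I1_proj_H)
    I1_proj_neq0 I1_ind.

Local Notation D := I1_integro_diff.
Local Notation S := (I1_integ K).
Local Notation T := (I1_deriv K).

Lemma I1_eE i j : I1_e K i j = S ^+ i * (1 - S * T) * T ^+ j.
Proof. by rewrite /I1_e mulrBr mulr1 mulrBl exprSr exprS !mulrA. Qed.

(** If [T ^+ n * v = 0], then [v] is the sum of its rows [S ^+ i * e * T ^+ i * v]
    with [i < n], and each of them is finite. *)
Lemma I1_F_finite_part v : I1_F K v <-> finite_part D v.
Proof.
split=> [[n [c ->]]|[n vn]].
  exists n; rewrite mulr_sumr big1// => i _; rewrite mulr_sumr big1// => j _.
  rewrite -scalerAr I1_eE.
  have -> : T ^+ n * (S ^+ i * (1 - S * T) * T ^+ j) = 0.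
    have -> : T ^+ n = T ^+ (n - i.+1) * T ^+ i.+1 by rewrite -exprD subnK.
    rewrite exprS !mulrA.
    rewrite -(mulrA (_ * T)) (deriv_integX D) mulr1.
    by rewrite -(mulrA _ T) (deriv_proj D) mulr0 mul0r.
  by rewrite scaler0.
have rows i : exists w, (1 - S * T) * (T ^+ i * v) = first_row D w.
  have [w wE] := first_row_mul D 'X^i v; exists w; rewrite -wE.
  by rewrite -['X^i]mul1r (first_rowMXn D) (first_rowC D) rmorph1 mulr1 mulrA.
have [w wE] := choice rows.
(* A square matrix has to accommodate the [n] rows and all their lengths. *)
pose m := (n + \sum_(i < n) size (w i))%N.
have wm i : (size (w i) <= m)%N.
  have [ni|ni] := ltnP i n.
    by rewrite /m (bigD1 (Ordinal ni))//= addnCA leq_addr.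
  suff -> : w i = 0 by rewrite size_poly0.
  by apply: (first_row_eq0 (D := D)); rewrite -wE -(subnK ni) exprD -mulrA vn !mulr0.
exists m, (\matrix_(i, j) (w i)`_j).
have rowE (u : {poly K}) : (size u <= m)%N ->
    first_row D u = \sum_(j < m) u`_j *: ((1 - S * T) * T ^+ j).
  move=> um; rewrite /first_row /ore_eval.
  rewrite (@horner_coef_wide _ m); last first.
    by rewrite (leq_trans (size_poly _ _))// (leq_trans (size_poly _ _)).
  rewrite mulr_sumr; apply: eq_bigr => j _.
  by rewrite !coef_map /= I1_coefHC -!scalerAl mul1r -scalerAr.
have vm : T ^+ m * v = 0 by rewrite /m addnC exprD -mulrA vn mulr0.
rewrite {1}(sum_integ_proj_deriv D m v) vm mulr0 add0r.
apply: eq_bigr => i _; rewrite wE rowE// mulr_sumr; apply: eq_bigr => j _.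
by rewrite mxE I1_eE -scalerAr mulrA.
Qed.

End Concrete.

Theorem theorem3p6 (K : fieldType) (charK : [pchar K] =i pred0) (a : I1 K) :
  (* left I1-modules, b |-> b * a *)
  (((mlength (ker (@right_mul (I1 K) a)) < +oo)%E <->
      (mlength (coker (@right_mul (I1 K) a)) < +oo)%E) /\
   ((mlength (coker (@right_mul (I1 K) a)) < +oo)%E <-> a \notin I1_F K) /\
   ((mlength (im (@right_mul (I1 K) a)) < +oo)%E <-> a \in I1_F K)) /\
  (* right I1-modules, b |-> a * b *)
  (((mlength (ker (@left_mul (I1 K) a)) < +oo)%E <->
      (mlength (coker (@left_mul (I1 K) a)) < +oo)%E) /\
   ((mlength (coker (@left_mul (I1 K) a)) < +oo)%E <-> a \notin I1_F K) /\
   ((mlength (im (@left_mul (I1 K) a)) < +oo)%E <-> a \in I1_F K)).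
Proof.
pose D := I1_integro_diff charK.
have F : a \in I1_F K <-> finite_part D a.
  by rewrite in_setE; exact: I1_F_finite_part.
have F' : a \in I1_F K <-> finite_part (integro_diff_converse D) a.
  by rewrite finite_part_converse.
have -> : a \notin I1_F K <-> ~ a \in I1_F K by split=> /negP.
split.
  have fE b : right_mul a b = b * a by [].
  rewrite F (mlength_ker_right_mul D charK fE) (mlength_coker_right_mul D charK fE).
  by rewrite (mlength_im_right_mul D charK fE).
rewrite F' (mlength_ker_left_mul D a charK) (mlength_coker_left_mul D a charK).
by rewrite (mlength_im_left_mul D a charK).
Qed.
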